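(* Let $\mathcal{A}\in\mathbb{K}_l^{m\times r}$, $\mathcal{B}\in\mathbb{K}_l^{s\times n}$, $\mathcal{C}\in\mathbb{K}_l^{m\times n}$, let $\mathcal{M}\in\mathbb{K}_l^{r\times r}$ and $\mathcal{N}\in\mathbb{K}_l^{s\times s}$ be T-symmetric T-positive definite, and let $\mathfrak{D}_{\mathcal{S}}$, $\mathfrak{D}_{\mathcal{V}}$ be fixed probability distributions over random tubal matrices in $\mathbb{K}_l^{m\times\tau}$ and $\mathbb{K}_l^{n\times\zeta}$. For independent $\mathcal{S}\sim\mathfrak{D}_{\mathcal{S}}$, $\mathcal{V}\sim\mathfrak{D}_{\mathcal{V}}$ let $$\mathcal{Z}=\mathcal{M}^{-\frac12}*\mathcal{A}^{T}*\mathcal{S}*(\mathcal{S}^{T}*\mathcal{A}*\mathcal{M}^{-1}*\mathcal{A}^{T}*\mathcal{S})^{\dag}*\mathcal{S}^{T}*\mathcal{A}*\mathcal{M}^{-\frac12},$$ $$\mathcal{W}=\mathcal{N}^{-\frac12}*\mathcal{B}*\mathcal{V}*(\mathcal{V}^{T}*\mathcal{B}^{T}*\mathcal{N}^{-1}*\mathcal{B}*\mathcal{V})^{\dag}*\mathcal{V}^{T}*\mathcal{B}^{T}*\mathcal{N}^{-\frac12}.$$ Assume that $\mathbb{E}[\mathrm{bdiag}(\widehat{\mathcal{Z}})]$ and $\mathbb{E}[\mathrm{bdiag}(\widehat{\mathcal{W}})]$ are Hermitian positive definite. Let $\mathcal{X}^{\star}$ satisfy $\mathcal{A}*\mathcal{X}^{\star}*\mathcal{B}=\mathcal{C}$.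 Let the sequence $\{\mathcal{X}^t\}$ be generated from $\mathcal{X}^{0}\in\mathbb{K}_l^{r\times s}$ by the TESP method in the Fourier domain: at each step draw fresh independent $\mathcal{S}\sim\mathfrak{D}_{\mathcal{S}}$, $\mathcal{V}\sim\mathfrak{D}_{\mathcal{V}}$ (independent also of the past), and for $k=1,\dots,\lceil\frac{l+1}{2}\rceil$ set $$\widehat{\mathcal{E}}_{(k)}=\widehat{\mathcal{S}}_{(k)}\big(\widehat{\mathcal{S}}_{(k)}^{H}\widehat{\mathcal{A}}_{(k)}\widehat{\mathcal{M}}_{(k)}^{-1}\widehat{\mathcal{A}}_{(k)}^{H}\widehat{\mathcal{S}}_{(k)}\big)^{\dag}\widehat{\mathcal{S}}_{(k)}^{H},\quad \widehat{\mathcal{G}}_{(k)}=\widehat{\mathcal{V}}_{(k)}\big(\widehat{\mathcal{V}}_{(k)}^{H}\widehat{\mathcal{B}}_{(k)}^{H}\widehat{\mathcal{N}}_{(k)}^{-1}\widehat{\mathcal{B}}_{(k)}\widehat{\mathcal{V}}_{(k)}\big)^{\dag}\widehat{\mathcal{V}}_{(k)}^{H},$$ $$\widehat{\mathcal{X}}^{t+1}_{(k)}=\widehat{\mathcal{X}}^{t}_{(k)}-\widehat{\mathcal{M}}_{(k)}^{-1}\widehat{\mathcal{A}}_{(k)}^{H}\widehat{\mathcal{E}}_{(k)}\big(\widehat{\mathcal{A}}_{(k)}\widehat{\mathcal{X}}^{t}_{(k)}\widehat{\mathcal{B}}_{(k)}-\widehat{\mathcal{C}}_{(k)}\big)\widehat{\mathcal{G}}_{(k)}\widehat{\mathcal{B}}_{(k)}^{H}\widehat{\mathcal{N}}_{(k)}^{-1},$$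 and for $k=\lceil\frac{l+1}{2}\rceil+1,\dots,l$ set $\widehat{\mathcal{X}}^{t+1}_{(k)}=\mathrm{conj}(\widehat{\mathcal{X}}^{t+1}_{(l-k+2)})$; $\mathcal{X}^{t+1}$ is the inverse DFT along the third mode of $\widehat{\mathcal{X}}^{t+1}$. Then for all $t\ge 1$ $$\mathbb{E}\left[\|\mathcal{X}^{t}-\mathcal{X}^{\star}\|_{F(\mathcal{M},\mathcal{N})}^{2}\mid\mathcal{X}^{0}\right]\le\rho^{t}\,\|\mathcal{X}^{0}-\mathcal{X}^{\star}\|_{F(\mathcal{M},\mathcal{N})}^{2},\qquad \rho=1-\min_{1\le k\le l}\lambda_{\min}\big(\mathbb{E}[\widehat{\mathcal{Z}}_{(k)}]\big)\,\lambda_{\min}\big(\mathbb{E}[\widehat{\mathcal{W}}_{(k)}]\big).$$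
   Context: Fix $l\ge 1$. $\mathbb{K}_l^{m\times n}=\mathbb{R}^{m\times n\times l}$ (tubal matrices), $\mathbb{K}_l^{m}=\mathbb{K}_l^{m\times 1}$. $\mathcal{A}_{(k)}$ is the $k$-th frontal slice $\mathcal{A}(:,:,k)$. $\widehat{\mathcal{A}}=\mathtt{fft}(\mathcal{A},[\,],3)$ is the (unnormalized) discrete Fourier transform along the third mode: $\widehat{\mathcal{A}}_{(k)}=\sum_{p=1}^{l}e^{-2\pi \mathrm{i}(k-1)(p-1)/l}\mathcal{A}_{(p)}$. $\mathrm{bdiag}(\widehat{\mathcal{A}})$ is the block diagonal matrix with diagonal blocks $\widehat{\mathcal{A}}_{(1)},\dots,\widehat{\mathcal{A}}_{(l)}$. ${}^H$ is conjugate transpose and, for matrices, ${}^\dag$ is the usual Moore–Penrose inverse. $\mathrm{unfold}(\mathcal{A})$ is the block column with blocks $\mathcal{A}_{(1)},\dots,\mathcal{A}_{(l)}$, $\mathrm{fold}$ is its inverse, and $\mathrm{bcirc}(\mathcal{A})$ is the block circulant matrix whose first block column is $\mathrm{unfold}(\mathcal{A})$ (block $(p,q)$ is $\mathcal{A}_{(((p-q)\bmod l)+1)}$). The t-product is $\mathcal{A}*\mathcal{B}=\mathrm{fold}(\mathrm{bcirc}(\mathcal{A})\,\mathrm{unfold}(\mathcal{B}))$; equivalently $\widehat{(\mathcal{A}*\mathcal{B})}_{(k)}=\widehat{\mathcal{A}}_{(k)}\widehat{\mathcal{B}}_{(k)}$. The identity $\mathcal{I}_n$ has first frontal slice the identity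 matrix and other slices zero; $\mathcal{A}^{-1}$ is the two-sided inverse with respect to $*$. Transpose: $(\mathcal{A}^{T})_{(1)}=\mathcal{A}_{(1)}^{T}$, $(\mathcal{A}^{T})_{(k)}=\mathcal{A}_{(l-k+2)}^{T}$ for $k\ge2$. Slice transpose: $(\mathcal{A}^{ST})_{(k)}=\mathcal{A}_{(k)}^{T}$ for all $k$. For tubal matrices $\mathcal{A}^{\dag}$ is the unique Moore–Penrose inverse (the four Penrose equations with $*$ and ${}^T$). $\langle\cdot,\cdot\rangle$ is the entrywise inner product. $\mathcal{M}$ is T-symmetric T-positive definite if $\mathcal{M}=\mathcal{M}^{T}$ and $\langle\overrightarrow{\mathcal{X}},\mathcal{M}*\overrightarrow{\mathcal{X}}\rangle>0$ for all nonzero $\overrightarrow{\mathcal{X}}$. $\mathcal{M}^{\frac12}$ is defined by $\mathrm{bcirc}(\mathcal{M}^{\frac12})=\mathrm{bcirc}(\mathcal{M})^{\frac12}$, and $\mathcal{M}^{-\frac12}=(\mathcal{M}^{\frac12})^{-1}$. $\mathrm{vec}_t(\mathcal{A})\in\mathbb{K}_l^{mn}$ stacks vertically the lateral slices $\mathcal{A}_{(:,1,:)},\dots,\mathcal{A}_{(:,n,:)}$. $\mathcal{A}\otimes_t\mathcal{B}$ is the block tubal matrix with $(i,j)$ block $\mathcal{A}_{(i,j,:)}*\mathcal{B}$ (the tube t-multiplied with every tube of $\mathcal{B}$). $\|\mathcal{X}\|_{F(\mathcal{M},\mathcal{N})}^{2}=\langle(\mathcal{N}^{ST}\otimes_t\mathcal{M})*\mathrm{vec}_t(\mathcal{X}),\mathrm{vec}_t(\mathcal{X})\rangle$,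 which equals $\|\mathcal{M}^{\frac12}*\mathcal{X}*\mathcal{N}^{\frac12}\|_F^2$. Expectations are entrywise; $\lambda_{\min}$ is the smallest eigenvalue. *)

(* Defs.v *)
From HB Require Import structures.
From mathcomp Require Import all_boot all_order all_algebra.
From mathcomp Require Import sesquilinear spectral.
From mathcomp Require Import complex.
From mathcomp Require Import all_classical all_reals all_analysis.
From mathcomp Require Import measurable_realfun.

Set Implicit Arguments.
Unset Strict Implicit.
Unset Printing Implicit Defensive.

Import Order.TTheory GRing.Theory Num.Theory.

Local Open Scope classical_set_scope.
Local Open Scope sesquilinear_scope.
Local Open Scope complex_scope.
Local Open Scope ring_scope.

(* Tubal matrices with tubes of length l.+1, as families of frontal slices.
   Slices are numbered from 0, so the 1-based slice number k is the ordinal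
   k - 1 of 'I_l.+1; index arithmetic such as [p - q] or [- k] is that of the
   additive group 'I_l.+1, hence modulo l.+1. *)
Definition tubal (K : Type) (l m n : nat) : Type := 'I_l.+1 -> 'M[K]_(m, n).

HB.instance Definition _ (K : choiceType) (l m n : nat) :=
  Choice.copy (tubal K l m n) ('I_l.+1 -> 'M[K]_(m, n)).

Section TubalAlgebra.
Variables (K : pzRingType) (l : nat).

Definition tzero {m n} : tubal K l m n := fun=> 0.

Definition tid n : tubal K l n n := fun k => if k == 0 then 1%:M else 0.

Definition tsub {m n} (A B : tubal K l m n) : tubal K l m n :=
  fun k => A k - B k.

Definition tunfold {m n} (A : tubal K l m n) : 'M[K]_(\sum_(p < l.+1) m, n) :=
  \mxcol_(p < l.+1) A p.

Definition tfold {m n} (U : 'M[K]_(\sum_(p < l.+1) m, n)) : tubal K l m n :=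
  fun p => submxcol U p.

Definition bcirc {m n} (A : tubal K l m n) :
    'M[K]_(\sum_(p < l.+1) m, \sum_(q < l.+1) n) :=
  \mxblock_(p < l.+1, q < l.+1) A (p - q).

Definition tprod {m n s} (A : tubal K l m n) (B : tubal K l n s) :
    tubal K l m s :=
  tfold (bcirc A *m tunfold B).

(* In 0-based numbering the reflection k |-> l - k + 2 is negation mod l.+1,
   and it fixes the first slice. *)
Definition ttr {m n} (A : tubal K l m n) : tubal K l n m :=
  fun k => (A (- k))^T.

Definition tslicetr {m n} (A : tubal K l m n) : tubal K l n m :=
  fun k => (A k)^T.

Definition tinner {m n} (A B : tubal K l m n) : K :=
  \sum_(k < l.+1) \sum_(i < m) \sum_(j < n) A k i j * B k i j.

Definition tube {m n} (A : tubal K l m n) (i : 'I_m) (j : 'I_n) :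
    tubal K l 1 1 :=
  fun k => (A k i j)%:M.

Definition tubeprod {m n} (a : tubal K l 1 1) (B : tubal K l m n) :
    tubal K l m n :=
  fun k => \matrix_(i, j) tprod a (tube B i j) k 0 0.

Definition tkron {m n p q} (A : tubal K l m n) (B : tubal K l p q) :
    tubal K l (\sum_(i < m) p) (\sum_(j < n) q) :=
  fun k => \mxblock_(i < m, j < n) tubeprod (tube A i j) B k.

Definition vect {m n} (A : tubal K l m n) : tubal K l (\sum_(j < n) m) 1 :=
  fun k => \mxcol_(j < n) col j (A k).

End TubalAlgebra.

Arguments tzero {K l m n}.
Arguments tid {K l} n.

HB.instance Definition _ (K : pzRingType) (l m n : nat) :=
  isPointed.Build (tubal K l m n) tzero.

Declare Scope tubal_scope.
Delimit Scope tubal_scope with T.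
Notation "A ** B" := (tprod A B)
  (at level 40, left associativity) : tubal_scope.
Local Open Scope tubal_scope.

Section RealTubal.
Variables (R : realType) (l : nat).
Local Notation tubalR := (tubal R l).

(* Inverses, Moore-Penrose inverses and (symmetric positive semidefinite)
   square roots are the unique objects with the stated properties; the value
   is 0 when there is none. *)
Definition tinv {n} (A : tubalR n n) : tubalR n n :=
  xget (tzero) [set X | A ** X = tid n /\ X ** A = tid n].

Definition tpinv {m n} (A : tubalR m n) : tubalR n m :=
  xget (tzero) [set X | [/\ A ** X ** A = A,
                                X ** A ** X = X,
                                ttr (A ** X) = A ** X &
                                ttr (X ** A) = X ** A]].

Definition T_posdef {n} (M : tubalR n n) : Prop :=
  M = ttr M /\
  forall X : tubalR n 1, X <> tzero -> 0 < tinner X (M ** X).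

Definition mxsqrt {n} (A : 'M[R]_n) : 'M[R]_n :=
  xget 0 [set Q | [/\ Q^T = Q,
                      forall x : 'cV[R]_n, 0 <= (x^T *m Q *m x) 0 0 &
                      Q *m Q = A]].

Definition tsqrt {n} (M : tubalR n n) : tubalR n n :=
  xget (tzero) [set X | bcirc X = mxsqrt (bcirc M)].

(* The square of the norm ‖X‖_{F(M,N)}. *)
Definition sqnormF {r s} (M : tubalR r r) (N : tubalR s s) (X : tubalR r s) : R :=
  tinner (tkron (tslicetr N) M ** vect X) (vect X).

End RealTubal.

Section Fourier.
Variable R : realType.
Local Notation C := R[i].

Definition cis (x : R) : C := cos x +i* sin x.

Definition dft {l m n} (A : tubal R l m n) : tubal C l m n :=
  fun k => \sum_(p < l.+1)
    cis (- (2 * pi * (k * p)%N%:R / l.+1%:R)) *: map_mx (real_complex R) (A p).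

Definition idft {l m n} (A : tubal C l m n) : tubal C l m n :=
  fun p => (l.+1%:R)^-1 *: \sum_(k < l.+1)
    cis (2 * pi * (k * p)%N%:R / l.+1%:R) *: A k.

Definition tcomplex {l m n} (A : tubal R l m n) : tubal C l m n :=
  fun k => map_mx (real_complex R) (A k).

Definition bdiag {l n} (A : tubal C l n n) : 'M[C]_(\sum_(k < l.+1) n) :=
  \mxdiag_(k < l.+1) A k.

Definition mxpinv {m n} (A : 'M[C]_(m, n)) : 'M[C]_(n, m) :=
  xget 0 [set X | [/\ A *m X *m A = A,
                      X *m A *m X = X,
                      (A *m X)^t* = A *m X &
                      (X *m A)^t* = X *m A]].

Definition herm_posdef {n} (A : 'M[C]_n) : Prop :=
  A \is hermsymmx /\
  forall x : 'cV[C]_n, x != 0 -> 0 < (x^t* *m A *m x) 0 0.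

(* Smallest eigenvalue of a Hermitian matrix (whose eigenvalues are real). *)
Definition lambda_min {n} (A : 'M[C]_n) : R :=
  inf [set a : R | eigenvalue A a%:C].

End Fourier.

Section RandomTubal.
Variable R : realType.

(* Generators of the Borel (= product) sigma-algebra on real tubal matrices. *)
Definition tubal_cylinder l m n : set (set (tubal R l m n)) :=
  [set E | exists (k : 'I_l.+1) (i : 'I_m) (j : 'I_n) (B : set R),
     measurable B /\ E = [set A : tubal R l m n | B (A k i j)]].

End RandomTubal.

Notation mtubal R l m n := (g_sigma_algebraType (@tubal_cylinder R l m n)).

Section Expectations.
Variable R : realType.

Definition Emx d (T : measurableType d) (P : probability T R) p q
    (F : T -> 'M[R[i]]_(p, q)) : 'M[R[i]]_(p, q) :=
  \matrix_(i, j) ((\int[P]_w complex.Re (F w i j))%R +i*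
                  (\int[P]_w complex.Im (F w i j))%R).

Definition mutually_independent d (T : measurableType d) (P : probability T R)
    (I : eqType) (F : I -> set (set T)) : Prop :=
  forall (J : seq I) (E : I -> set T), uniq J ->
    (forall i, i \in J -> F i (E i)) ->
    P (\bigcap_(i in [set` J]) E i) = \big[*%E/1%E]_(i <- J) P (E i).

(* Y is a version of E[U | G], for a sub-sigma-algebra G and a nonnegative
   random variable U, not necessarily integrable. *)
Definition cond_expectation d (T : measurableType d) (P : probability T R)
    (G : set (set T)) (U Y : T -> \bar R) : Prop :=
  (forall B : set (\bar R), measurable B -> G (Y @^-1` B)) /\
  (forall E, G E -> \int[P]_(w in E) Y w = \int[P]_(w in E) U w)%E.

(* The sigma-algebras of the initial iterate (index None), of the t-th left
   sketch (Some (inl t)) and of the t-th right sketch (Some (inr t)). *)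
Definition source_sigma d (T : measurableType d)
    d0 d1 d2 (T0 : measurableType d0) (T1 : measurableType d1)
    (T2 : measurableType d2) (X0 : T -> T0) (S : nat -> T -> T1)
    (V : nat -> T -> T2) (i : option (nat + nat)) : set (set T) :=
  match i with
  | None => g_sigma_algebra_preimage X0
  | Some (inl t) => g_sigma_algebra_preimage (S t)
  | Some (inr t) => g_sigma_algebra_preimage (V t)
  end.

End Expectations.

Section TESP.
Variables (R : realType) (l m n r s : nat).
Local Notation tubalR := (tubal R l).
Local Notation C := R[i].
Local Notation tubalC := (tubal C l r s).
Variables (A : tubalR m r) (B : tubalR s n) (Cc : tubalR m n).
Variables (M : tubalR r r) (N : tubalR s s).

Definition Zproj tau (S : tubalR m tau) : tubalR r r :=
  tinv (tsqrt M) ** ttr A ** S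
    ** tpinv (ttr S ** A ** tinv M ** ttr A ** S)
    ** ttr S ** A ** tinv (tsqrt M).

Definition Wproj zeta (V : tubalR n zeta) : tubalR s s :=
  tinv (tsqrt N) ** B ** V
    ** tpinv (ttr V ** ttr B ** tinv N ** B ** V)
    ** ttr V ** ttr B ** tinv (tsqrt N).

Definition Ehat tau (S : tubalR m tau) (k : 'I_l.+1) : 'M[C]_m :=
  dft S k
    *m mxpinv ((dft S k)^t* *m dft A k *m invmx (dft M k) *m (dft A k)^t*
               *m dft S k)
    *m (dft S k)^t*.

Definition Ghat zeta (V : tubalR n zeta) (k : 'I_l.+1) : 'M[C]_n :=
  dft V k
    *m mxpinv ((dft V k)^t* *m (dft B k)^t* *m invmx (dft N k) *m dft B k
               *m dft V k)
    *m (dft V k)^t*.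

Definition tesp_slice tau zeta (S : tubalR m tau) (V : tubalR n zeta)
    (Xh : tubalC) (k : 'I_l.+1) : 'M[C]_(r, s) :=
  Xh k - invmx (dft M k) *m (dft A k)^t* *m Ehat S k
           *m (dft A k *m Xh k *m dft B k - dft Cc k)
           *m Ghat V k *m (dft B k)^t* *m invmx (dft N k).

(* One step in the Fourier domain: the slices whose 1-based number is at most
   ceil((l.+1 + 1) / 2) are updated, the others are conjugates of those. *)
Definition tesp_step tau zeta (S : tubalR m tau) (V : tubalR n zeta)
    (Xh : tubalC) : tubalC :=
  fun k => if (k.+1 <= uphalf l.+2)%N then tesp_slice S V Xh k
           else map_mx Num.conj (tesp_slice S V Xh (- k)).

Definition tesp_rho tau zeta
    (DS : probability (mtubal R l m tau) R)
    (DV : probability (mtubal R l n zeta) R) : R :=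
  let f k := lambda_min (Emx DS (fun S => dft (Zproj S) k)) *
             lambda_min (Emx DV (fun V => dft (Wproj V) k)) in
  1 - \big[Num.min/f ord0]_(k < l.+1) f k.

End TESP.

(* Main.v *)
(* With [E_t = M^(1/2) * (X_t - Xstar) * N^(1/2)], one step of the method reads
   [E_(t+1) = E_t - Z_t * E_t * W_t], where [Z_t] and [W_t] are orthogonal
   projections in the tubal algebra.  Hence
     [|E_(t+1)|^2 = |E_t|^2 - <E_t, Z_t * E_t * W_t>],
   and by independence the last term may be averaged over the fresh sketches,
   which replaces [Z_t], [W_t] by [E Z], [E W].  On the Fourier slices
   [tr (E^H (E Z)_k E (E W)_k) >= lambda_min lambda_min |E|^2], so Parseval's
   identity gives the contraction factor [rho].

   All probability is carried out on the real entries of [Z], [W], [E_t]: they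
   are polynomials in bounded functions of the independent sources, once the
   initial iterate is truncated to a set where [|E_0|] is bounded.  Such a
   projection is a measurable function of the sketch, being, in block circulant
   form, the limit of [1 - (1 + c Q Q^T)^-1] as [c] tends to infinity.  The
   bound on the conditional expectation follows by integrating over the sets
   where it would fail. *)

Require Import Defs.
From mathcomp Require Import all_boot all_order all_algebra.
From mathcomp Require Import sesquilinear spectral.
From mathcomp Require Import complex.
From mathcomp Require Import all_classical all_reals all_analysis.
From mathcomp Require Import measurable_realfun.
From mathcomp Require Import ring lra.

Import Order.TTheory GRing.Theory Num.Theory numFieldNormedType.Exports.

Local Open Scope classical_set_scope.
Local Open Scope sesquilinear_scope.
Local Open Scope tubal_scope.
Local Open Scope ring_scope.

(** * Hermitian matrices *)

(** [tinv], [tpinv] and [tsqrt] are chosen among real tubal matrices by a defining property, so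
    nothing can be said of them before a solution is exhibited. Solutions are found slice by slice
    over the complex numbers. They come from a real tubal matrix when the slices at [k] and [- k]
    are conjugate; for pseudo-inverses and roots this symmetry is a consequence of their uniqueness
    on each slice. The Moore-Penrose inverse is discontinuous where the rank drops, so measurability
    cannot be had from continuity; this is why ordinary inverses and a limit are used. The initial
    iterate need not be integrable, and a version of the conditional expectation takes extended real
    values. The truncation event depends on [X0] alone, so it is admissible in the definition of
    conditional expectation; its indicator is carried as a nonnegative weight through the one-step
    estimate. The sign of [rho] is not visible in its definition. That the claimed bound is
    nonnegative is read off from the one-step estimate, applied to a deterministic error. *)

Section HermitianMatrices.
Context {C : numClosedFieldType}.

Lemma trmxC_mul {m n p} (A : 'M[C]_(m, n)) (B : 'M[C]_(n, p)) :
  (A *m B)^t* = B^t* *m A^t*.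
Proof. by rewrite trmx_mul map_mxM. Qed.

Lemma trmxCE {m n} (A : 'M[C]_(m, n)) i j : (A^t*) i j = (A j i)^*.
Proof. by rewrite !mxE. Qed.

Lemma trmxCB {m n} (A B : 'M[C]_(m, n)) : (A - B)^t* = A^t* - B^t*.
Proof. by rewrite linearB /= map_mxB. Qed.

Lemma trmxCD {m n} (A B : 'M[C]_(m, n)) : (A + B)^t* = A^t* + B^t*.
Proof. by rewrite linearD /= map_mxD. Qed.

Lemma trmxC_scale {m n} (a : C) (A : 'M[C]_(m, n)) :
  (a *: A)^t* = a^* *: A^t*.
Proof. by rewrite linearZ /= map_mxZ. Qed.

Lemma trmxC_inv n (A : 'M[C]_n) : (invmx A)^t* = invmx (A^t*).
Proof. by rewrite trmx_inv map_invmx. Qed.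

Lemma mxtrace_sqrE {m n} (A : 'M[C]_(m, n)) :
  \tr (A^t* *m A) = \sum_j \sum_i `|A i j| ^+ 2.
Proof.
rewrite /mxtrace; apply: eq_bigr => j _; rewrite mxE.
by apply: eq_bigr => i _; rewrite trmxCE mulrC normCK.
Qed.

Lemma mxtrace_sqr_ge0 {m n} (A : 'M[C]_(m, n)) : 0 <= \tr (A^t* *m A).
Proof.
by rewrite mxtrace_sqrE; do 2!apply: sumr_ge0 => ? _; rewrite exprn_ge0.
Qed.

Lemma mxtrace_sqr_eq0 {m n} (A : 'M[C]_(m, n)) : \tr (A^t* *m A) = 0 -> A = 0.
Proof.
rewrite mxtrace_sqrE => A0; apply/matrixP => i j; rewrite mxE.
have ge0 (i' : 'I_m) (j' : 'I_n) : 0 <= `|A i' j'| ^+ 2 by rewrite exprn_ge0.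
have /psumr_eq0P - /(_ (fun j _ => sumr_ge0 _ (fun i _ => ge0 i j))) := A0.
move=> /(_ j isT) /psumr_eq0P - /(_ (fun i _ => ge0 i j)) /(_ i isT) /eqP.
by rewrite expf_eq0 /= normr_eq0 => /eqP.
Qed.

Definition psdmx {n} (A : 'M[C]_n) :=
  A^t* = A /\ forall x : 'cV[C]_n, 0 <= (x^t* *m A *m x) 0 0.

Lemma hermsymmx_trmxC n (A : 'M[C]_n) : (A \is hermsymmx) <-> A^t* = A.
Proof.
split=> [/is_hermitianmxP|AA]; first by rewrite expr0 scale1r.
by apply/is_hermitianmxP; rewrite expr0 scale1r.
Qed.

Lemma hermitian_diag {n} {A : 'M[C]_n} : A^t* = A ->
  exists (U : 'M[C]_n) (d : 'rV[C]_n),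
    [/\ U *m U^t* = 1%:M, U^t* *m U = 1%:M, forall i, (d 0 i)^* = d 0 i &
        A = U^t* *m diag_mx d *m U].
Proof.
move=> /hermsymmx_trmxC Ah.
have UU := spectral_unitarymx A.
exists (spectralmx A), (spectral_diag A); split.
- exact/unitarymxP.
- by rewrite -invmx_unitary// mulVmx// spectral_unit.
- move=> i; apply/CrealP.
  by have /mxOverP/(_ 0 i) := hermitian_spectral_diag_real Ah.
- rewrite -invmx_unitary//.
  by have /hermitian_normalmx/orthomx_spectralP := Ah.
Qed.

Lemma quad_diag {n} {U A : 'M[C]_n} {d : 'rV[C]_n} (x : 'cV[C]_n) :
  A = U^t* *m diag_mx d *m U ->
  (x^t* *m A *m x) 0 0 = \sum_i d 0 i * `|(U *m x) i 0| ^+ 2.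
Proof.
move=> ->; set y := U *m x.
have -> : x^t* *m (U^t* *m diag_mx d *m U) *m x = y^t* *m diag_mx d *m y.
  by rewrite /y trmxC_mul !mulmxA.
rewrite mxE; apply: eq_bigr => i _.
rewrite mul_mx_diag mxE trmxCE normCK mulrAC mulrC; congr (_ * _).
by rewrite mulrC.
Qed.

Lemma psdmx_diag {n} {U A : 'M[C]_n} {d : 'rV[C]_n} :
  U *m U^t* = 1%:M -> A = U^t* *m diag_mx d *m U ->
  (forall x : 'cV[C]_n, 0 <= (x^t* *m A *m x) 0 0) -> forall i, 0 <= d 0 i.
Proof.
move=> UU AE Age0 i.
have := Age0 (U^t* *m delta_mx i 0).
rewrite (quad_diag _ AE) mulmxA UU mul1mx (bigD1 i)//= big1 ?addr0.
  by rewrite mxE !eqxx normr1 expr1n mulr1.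
by move=> j ji; rewrite mxE (negPf ji) normr0 expr0n mulr0.
Qed.

Lemma psd_sqrt n (A : 'M[C]_n) : psdmx A ->
  exists Q : 'M[C]_n, psdmx Q /\ Q *m Q = A.
Proof.
move=> [Ah Age0]; have [U [d [UU UU' dr AE]]] := hermitian_diag Ah.
have d0 := psdmx_diag UU AE Age0.
pose e : 'rV[C]_n := \row_i sqrtC (d 0 i).
have e0 i : 0 <= e 0 i by rewrite mxE sqrtC_ge0.
exists (U^t* *m diag_mx e *m U); split; first split.
- rewrite !trmxC_mul trmxCK tr_diag_mx map_diag_mx mulmxA;
  congr (_ *m diag_mx _ *m _).
  by apply/rowP => i; rewrite [LHS]mxE; apply/CrealP/ger0_real.
- move=> x; rewrite (quad_diag x (erefl _)); apply: sumr_ge0 => i _.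
  by rewrite mulr_ge0// exprn_ge0.
- rewrite !mulmxA -(mulmxA _ U) UU mulmx1 -(mulmxA _ (diag_mx e)
  (diag_mx e)) mulmx_diag.
  rewrite AE; congr (_ *m diag_mx _ *m _).
  by apply/rowP => i; rewrite !mxE -expr2 sqrtCK.
Qed.

(** Writing [A = Q Q] with [Q] Hermitian turns the trace into the squared Frobenius norm of
    [Q D]. *)
Lemma psd_mxtrace_ge0 {m n} {A : 'M[C]_n} (D : 'M[C]_(n, m)) :
  psdmx A -> 0 <= \tr (D^t* *m A *m D).
Proof.
move=> /psd_sqrt[Q [[Qh _] QQ]].
have -> : D^t* *m A *m D = (Q *m D)^t* *m (Q *m D).
  by rewrite trmxC_mul Qh !mulmxA -(mulmxA _ Q Q) QQ.
exact: mxtrace_sqr_ge0.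
Qed.

Lemma psd_mxtrace_eq0 {m n} {A : 'M[C]_n} {D : 'M[C]_(n, m)} :
  psdmx A -> \tr (D^t* *m A *m D) = 0 -> A *m D = 0.
Proof.
move=> /psd_sqrt[Q [[Qh _] QQ]].
have -> : D^t* *m A *m D = (Q *m D)^t* *m (Q *m D).
  by rewrite trmxC_mul Qh !mulmxA -(mulmxA _ Q Q) QQ.
by move=> /mxtrace_sqr_eq0 QD0; rewrite -QQ -mulmxA QD0 mulmx0.
Qed.

(* With [D = P - Q] and [S = P + Q], [P^2 = Q^2] gives [S D + D S = 0], so
   [tr (D S D) = 0] by cyclicity and both [D P D] and [D Q D] vanish. *)
Lemma psd_sqrt_unique {n} {P Q : 'M[C]_n} :
  psdmx P -> psdmx Q -> P *m P = Q *m Q -> P = Q.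
Proof.
move=> Pp Qp PQ; set D := P - Q.
have Dh : D^t* = D by rewrite trmxCB Pp.1 Qp.1.
have SD : (P + Q) *m D = - (D *m (P + Q)).
  rewrite /D mulmxDl !mulmxBr mulmxBl !mulmxDr PQ.
  by rewrite opprB opprD [LHS]addrC !addrA subrK addrK.
have tr0 : \tr (D^t* *m P *m D) + \tr (D^t* *m Q *m D) = 0.
  rewrite -linearD /= -mulmxDl -mulmxDr Dh.
  have e : \tr (D *m (P + Q) *m D) = - \tr (D *m (P + Q) *m D).
    by rewrite -{1}mulmxA SD mulmxN linearN /= mulmxA -mulmxA mxtrace_mulC.
  apply/eqP; rewrite -[_ == 0](mulrn_eq0 _ 2) mulr2n.
  by rewrite {1}e addNr.
have P0 := psd_mxtrace_ge0 D Pp; have Q0 := psd_mxtrace_ge0 D Qp.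
move/eqP: tr0; rewrite paddr_eq0// => /andP[/eqP P1 /eqP Q1].
have PD := psd_mxtrace_eq0 Pp P1; have QD := psd_mxtrace_eq0 Qp Q1.
have /mxtrace_sqr_eq0/eqP : \tr (D^t* *m D) = 0.
  by rewrite Dh {1}/D mulmxBl PD QD subrr linear0.
by rewrite subr_eq0 => /eqP.
Qed.

Definition penrose {m n} (A : 'M[C]_(m, n)) (X : 'M[C]_(n, m)) :=
  [/\ A *m X *m A = A, X *m A *m X = X,
      (A *m X)^t* = A *m X & (X *m A)^t* = X *m A].

(** [A X] and [A Y] are Hermitian and each absorbs the other, so they agree, as do [X A] and [Y A];
    then [X = X A X = Y A X = Y A Y]. *)
Lemma penrose_unique {m n} {A : 'M[C]_(m, n)} {X Y : 'M[C]_(n, m)} :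
  penrose A X -> penrose A Y -> X = Y.
Proof.
move=> [AX XA AXh XAh] [AY YA AYh YAh].
have AXY : A *m X = A *m Y.
  rewrite -AXh -[in LHS]AY -(mulmxA (A *m Y)) trmxC_mul AXh AYh.
  by rewrite mulmxA AX.
have XYA : X *m A = Y *m A.
  rewrite -XAh -[in LHS]AY -mulmxA mulmxA trmxC_mul YAh XAh.
  by rewrite -!mulmxA (mulmxA A X) AX.
by rewrite -XA XYA -mulmxA AXY mulmxA YA.
Qed.

Lemma penrose_trmxC {m n} {A : 'M[C]_(m, n)} {X : 'M[C]_(n, m)} :
  penrose A X -> penrose (A^t*) (X^t*).
Proof.
move=> [AX XA AXh XAh]; split.
- by rewrite -!trmxC_mul mulmxA AX.
- by rewrite -!trmxC_mul mulmxA XA.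
- by rewrite -!trmxC_mul XAh XAh.
- by rewrite -!trmxC_mul AXh AXh.
Qed.

Lemma penrose_hermitian n (A X : 'M[C]_n) :
  A^t* = A -> penrose A X -> X^t* = X.
Proof.
by move=> Ah AX; apply: (penrose_unique _ AX); rewrite -{1}Ah;
  apply: penrose_trmxC.
Qed.

Lemma penrose_exists n (A : 'M[C]_n) : A^t* = A -> exists X, penrose A X.
Proof.
move=> /hermitian_diag [U [d [UU UU' dr AE]]].
(* Since [0^-1 = 0], [e] inverts the nonzero eigenvalues and vanishes at the others. *)
pose e : 'rV[C]_n := \row_i (d 0 i)^-1.
have mm (a b : 'rV[C]_n) : (U^t* *m diag_mx a *m U) *m (U^t* *m diag_mx b *m U) =
    U^t* *m diag_mx (\row_i (a 0 i * b 0 i)) *m U.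
  by rewrite !mulmxA -(mulmxA _ U) UU mulmx1 -(mulmxA _ (diag_mx a)
    (diag_mx b)) mulmx_diag.
have hh (a : 'rV[C]_n) : (forall i, (a 0 i)^* = a 0 i) ->
    (U^t* *m diag_mx a *m U)^t* = U^t* *m diag_mx a *m U.
  move=> ar; rewrite !trmxC_mul trmxCK tr_diag_mx map_diag_mx mulmxA.
  by congr (_ *m diag_mx _ *m _); apply/rowP => i; rewrite [LHS]mxE; exact: ar.
have diagE (a b : 'rV[C]_n) : a = b ->
    U^t* *m diag_mx a *m U = U^t* *m diag_mx b *m U by move=> ->.
have z (x : C) : x * x^-1 * x = x.
  by have [->|x0] := eqVneq x 0; rewrite ?mulr0// divff// mul1r.
have z' (x : C) : x^-1 * x * x^-1 = x^-1.
  by have [->|x0] := eqVneq x 0; rewrite ?invr0 ?mulr0// mulVf// mul1r.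
exists (U^t* *m diag_mx e *m U); rewrite AE; split; rewrite !mm ?hh//.
- by apply: diagE; apply/rowP => i; rewrite !mxE z.
- by apply: diagE; apply/rowP => i; rewrite !mxE z'.
- by move=> i; rewrite !mxE; apply/CrealP/rpredM; rewrite ?rpredV;
  apply/CrealP/dr.
- by move=> i; rewrite !mxE; apply/CrealP/rpredM; rewrite ?rpredV;
  apply/CrealP/dr.
Qed.

End HermitianMatrices.

(** * The ring of tubal matrices *)

Section TubalRing.
Context {K : pzRingType} {l : nat}.
Local Notation tubalK := (tubal K l).

Lemma tubalP {m n} (A B : tubalK m n) : (forall k, A k = B k) -> A = B.
Proof. exact: funext. Qed.

Lemma tprodE {m n s} (A : tubalK m n) (B : tubalK n s) p :
  (A ** B) p = \sum_q A (p - q) *m B q.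
Proof. by rewrite /tprod /tfold mul_mxblock_mxrow mxcolK. Qed.

Lemma bcircM {m n s} (A : tubalK m n) (B : tubalK n s) :
  bcirc (A ** B) = bcirc A *m bcirc B.
Proof.
rewrite /bcirc mul_mxblock; apply: eq_mxblock => p q.
rewrite tprodE (reindex_inj (addIr (- q))) /=; apply: eq_bigr => j _.
by rewrite opprB addrA subrK.
Qed.

(** The first block column already lists all slices. As [bcirc] is multiplicative, identities of
    matrix algebra such as associativity descend to the t-product. *)
Lemma bcirc_inj {m n} : injective (@bcirc K l m n).
Proof.
move=> A B AB; apply: tubalP => k.
have := congr1 (fun U => submxblock U k 0) AB.
by rewrite /bcirc !mxblockK subr0.
Qed.

Lemma bcircB {m n} (A B : tubalK m n) : bcirc (tsub A B) = bcirc A - bcirc B.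
Proof. by rewrite /bcirc -mxblockB. Qed.

Lemma bcirc_ttr {m n} (A : tubalK m n) : bcirc (ttr A) = (bcirc A)^T.
Proof.
by rewrite /bcirc tr_mxblock; apply: eq_mxblock => p q; rewrite /ttr opprB.
Qed.

Lemma tprodA {m n p q} (A : tubalK m n) (B : tubalK n p) (D : tubalK p q) :
  A ** (B ** D) = A ** B ** D.
Proof. by apply: bcirc_inj; rewrite !bcircM mulmxA. Qed.

Lemma ttrK {m n} (A : tubalK m n) : ttr (ttr A) = A.
Proof. by apply: tubalP => k; rewrite /ttr opprK trmxK. Qed.

End TubalRing.

Section TubalComRing.
Context {K : comPzRingType} {l : nat}.
Local Notation tubalK := (tubal K l).

Lemma ttrM {m n p} (A : tubalK m n) (B : tubalK n p) :
  ttr (A ** B) = ttr B ** ttr A.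
Proof. by apply: bcirc_inj; rewrite !(bcircM, bcirc_ttr) trmx_mul. Qed.

Lemma tinnerE {m n} (A B : tubalK m n) :
  tinner A B = \sum_k \tr ((A k)^T *m B k).
Proof.
rewrite /tinner; apply: eq_bigr => k _; rewrite exchange_big /=.
apply: eq_bigr => j _; rewrite mxE; apply: eq_bigr => i _.
by rewrite mxE.
Qed.

Lemma tinner_vect {m n} (A B : tubalK m n) :
  tinner (vect A) (vect B) = tinner A B.
Proof.
rewrite !tinnerE; apply: eq_bigr => k _.
rewrite /vect tr_mxcol mul_mxrow_mxcol linear_sum /=.
apply: eq_bigr => j _; rewrite /mxtrace big_ord1 !mxE.
by apply: eq_bigr => i _; rewrite !mxE.
Qed.

Lemma tubeprodE {m n} (a : 'I_l.+1 -> K) (B : tubalK m n) k :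
  tubeprod (fun p => (a p)%:M) B k = \sum_q a (k - q) *: B q.
Proof.
apply/matrixP => i j; rewrite mxE tprodE summxE summxE.
apply: eq_bigr => q _.
by rewrite mul_scalar_mx !mxE mulr1n.
Qed.

(** The tubal form of [vec (M X N) = (N^T kron M) vec X]. Slice transposition swaps the entries of
    [N] without reversing its tubes, so block [(i, j)] is the tube of [N] at [(j, i)] times [M]. *)
Lemma tkron_vect {r s} (M : tubalK r r) (N : tubalK s s) (X : tubalK r s) :
  tkron (tslicetr N) M ** vect X = vect (M ** X ** N).
Proof.
apply: tubalP => p; rewrite tprodE /vect.
transitivity (\mxcol_(i < s) \sum_q \sum_j
    tubeprod (tube (tslicetr N) i j) M (p - q) *m col j (X q)).
  rewrite mxcol_sum; apply: eq_bigr => q _.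
  by rewrite /tkron mul_mxblock_mxrow.
apply: eq_mxcol => i.
transitivity (\sum_q \sum_j \sum_u N (p - q - u) j i *: (M u *m col j (X q))).
  apply: eq_bigr => q _; apply: eq_bigr => j _.
  rewrite [X in X *m _](_ : _ = \sum_u N (p - q - u) j i *: M u).
    by rewrite mulmx_suml; apply: eq_bigr => u _; rewrite scalemxAl.
  rewrite -(tubeprodE (fun u => N u j i)); congr tubeprod.
  by apply: tubalP => u; rewrite /tube /tslicetr mxE.
rewrite tprodE colE mulmx_suml.
transitivity (\sum_v \sum_q \sum_j
    N v j i *: (M (p - v - q) *m col j (X q))); last first.
  apply: eq_bigr => v _; rewrite -mulmxA -colE tprodE mulmx_suml.
  apply: eq_bigr => q _; rewrite -mulmxA.
  have -> : X q *m col i (N v) = \sum_j N v j i *: col j (X q).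
    apply/colP => x; rewrite mxE summxE; apply: eq_bigr => j _.
    by rewrite !mxE mulrC.
  by rewrite mulmx_sumr; apply: eq_bigr => j _; rewrite -scalemxAr.
rewrite [RHS]exchange_big /=; apply: eq_bigr => q _.
(* The slice index [v] of [N] is traded for the index [u] of [M] by [v = p - q - u]. *)
rewrite [LHS]exchange_big [RHS](reindex_inj (inj_comp (addrI (p - q)) oppr_inj)).
apply: eq_bigr => u _ /=; apply: eq_bigr => j _.
congr (_ *: (M _ *m _)).
by rewrite -addrA -opprD [_ + q]addrAC subrK subKr.
Qed.

End TubalComRing.

(** * The Fourier transform along the tubes *)

Section FourierTransform.
Context {R : realType} {l : nat}.
Local Notation C := R[i].
Local Notation tubalR := (tubal R l).
Local Notation tubalC := (tubal C l).
Local Notation toC := (map_mx (real_complex R)).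

Lemma cisD (x y : R) : cis (x + y) = cis x * cis y.
Proof.
rewrite /cis cosD sinD; apply/eqP; rewrite eq_complex /= eqxx /=.
by rewrite addrC eqxx.
Qed.

Lemma cisN (x : R) : cis (- x) = (cis x)^*.
Proof. by rewrite /cis cosN sinN. Qed.

Lemma cis0 : cis (0 : R) = 1.
Proof. by rewrite /cis cos0 sin0. Qed.

Lemma cisMn (x : R) n : cis (x *+ n) = cis x ^+ n.
Proof.
by elim: n => [|n IHn]; rewrite ?mulr0n ?cis0// mulrS cisD IHn exprS.
Qed.

Lemma cis_2pi : cis (2 * pi : R) = 1.
Proof. by rewrite mulr_natl /cis cos2pi sin2pi. Qed.

(** The real part of [1 - cis (x *+ 2)] is [2 * sin x ^+ 2], and the half angle [x] has positive
    sine. *)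
Lemma cis_neq1 (x : R) : 0 < x < pi -> cis (x *+ 2) != 1.
Proof.
move=> /sin_gt0_pi sx; apply/eqP => /(congr1 (@complex.Re R)) /=.
rewrite cos_mulr2n => cx; have := cos2Dsin2 x.
have : 0 < sin x ^+ 2 by rewrite exprn_gt0.
lra.
Qed.

Definition zeta : C := cis (2 * pi / l.+1%:R).

Lemma zeta_expL : zeta ^+ l.+1 = 1.
Proof.
by rewrite /zeta -cisMn -(mulr_natr (2 * pi / _)) divfK ?cis_2pi// pnatr_eq0.
Qed.

(** The characters of the cyclic group ['I_l.+1]; [dft] uses their conjugates and [idft] the
    characters themselves. *)
Definition efun (k p : 'I_l.+1) : C := zeta ^+ (k * p).

Lemma efunE (k p : 'I_l.+1) : cis (2 * pi * (k * p)%N%:R / l.+1%:R) = efun k p.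
Proof. by rewrite /efun /zeta -cisMn -(mulr_natr (2 * pi / _)) mulrAC. Qed.

Lemma efunNE (k p : 'I_l.+1) : cis (- (2 * pi * (k * p)%N%:R / l.+1%:R)) =
  (efun k p)^*.
Proof. by rewrite cisN efunE. Qed.

Lemma efunC (k p : 'I_l.+1) : efun k p = efun p k.
Proof. by rewrite /efun mulnC. Qed.

Lemma efunD (k p q : 'I_l.+1) : efun k (p + q) = efun k p * efun k q.
Proof.
rewrite /efun !exprM -exprD /= expr_mod //.
by rewrite -exprM mulnC exprM zeta_expL expr1n.
Qed.

Lemma efun0 (k : 'I_l.+1) : efun k 0 = 1.
Proof. by rewrite /efun muln0 expr0. Qed.

Lemma efunJ (k p : 'I_l.+1) : efun k p * (efun k p)^* = 1.
Proof. by rewrite -efunE -cisN -cisD subrr cis0. Qed.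

Lemma efunN (k p : 'I_l.+1) : efun k (- p) = (efun k p)^*.
Proof.
have e : efun k (- p) * efun k p = 1 by rewrite -efunD addNr efun0.
by rewrite -[LHS]mulr1 -(efunJ k p) mulrA e mul1r.
Qed.

Lemma efunB (k p q : 'I_l.+1) : efun k (p - q) = efun k p * (efun k q)^*.
Proof. by rewrite efunD efunN. Qed.

(** Orthogonality of characters: for [p] nonzero, [zeta ^+ p] is a root of unity other than 1, and
    its geometric sum vanishes. *)
Lemma sum_efun (p : 'I_l.+1) : \sum_k efun k p = (p == 0)%:R * l.+1%:R.
Proof.
have [->|p0] := eqVneq p 0.
  by under eq_bigr do rewrite efun0; rewrite sumr_const card_ord mul1r.
rewrite mul0r.
pose z := zeta ^+ p.
have z1 : z != 1.
  have pL : (0 < p)%N by rewrite lt0n; apply: contra p0 => /eqP p0;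
    apply/eqP/val_inj.
  have -> : z = cis ((pi * p%:R / l.+1%:R) *+ 2).
    rewrite /z /zeta -cisMn; congr cis.
    rewrite -[LHS]mulr_natr -[RHS]mulr_natr.
    by move: (p%:R : R) (l.+1%:R^-1 : R) => x y; ring.
  apply: cis_neq1; rewrite divr_gt0 ?mulr_gt0 ?pi_gt0 ?ltr0n//=.
  by rewrite ltr_pdivrMr ?ltr0n// ltr_pM2l ?pi_gt0// ltr_nat.
have : (z - 1) * \sum_(k < l.+1) z ^+ k = 0.
  by rewrite -subrX1 -exprM mulnC exprM zeta_expL expr1n subrr.
move=> /eqP; rewrite mulf_eq0 subr_eq0 (negPf z1) /= => /eqP zs.
by rewrite -[RHS]zs; apply: eq_bigr => k _; rewrite /z /efun mulnC exprM.
Qed.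

Lemma dftE {m n} (A : tubalR m n) k :
  dft A k = \sum_p (efun k p)^* *: toC (A p).
Proof. by apply: eq_bigr => p _; rewrite efunNE. Qed.

Lemma idftE {m n} (A : tubalC m n) p :
  idft A p = (l.+1%:R)^-1 *: \sum_k efun k p *: A k.
Proof. by congr (_ *: _); apply: eq_bigr => k _; rewrite efunE. Qed.

Lemma natL_neq0 : (l.+1%:R : C) != 0.
Proof. by rewrite pnatr_eq0. Qed.

Lemma scale_delta_sum {V : lmodType C} (q : 'I_l.+1) (f : 'I_l.+1 -> V) :
  \sum_p (p - q == 0)%:R *: f p = f q.
Proof.
rewrite (bigD1 q)//= subrr eqxx scale1r big1 ?addr0// => p pq.
by rewrite subr_eq0 (negPf pq) scale0r.
Qed.

(** One half of Fourier inversion. The next iterate is known only through [idft]; this recovers its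
    Fourier slices. *)
Lemma dft_tcomplex {m n} (A : tubalR m n) (Y : tubalC m n) :
  tcomplex A = idft Y -> dft A = Y.
Proof.
move=> AY; apply: tubalP => k; rewrite dftE.
under eq_bigr => p _ do rewrite -[toC (A p)]/(tcomplex A p) AY idftE
  [_ *: (_ *: _)]scalerA [_ * _^-1]mulrC -scalerA scaler_sumr.
rewrite -scaler_sumr exchange_big /=.
transitivity ((l.+1%:R : C)^-1 *: \sum_j ((j - k == 0)%:R * l.+1%:R) *: Y j).
  congr (_ *: _); apply: eq_bigr => j _; rewrite -sum_efun scaler_suml.
  apply: eq_bigr => p _; rewrite scalerA mulrC efunB; congr (_ *: _).
  by rewrite (efunC j) (efunC k).
rewrite scaler_sumr -[RHS](scale_delta_sum k Y); apply: eq_bigr => j _.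
by rewrite scalerA mulrCA mulVf ?natL_neq0 ?mulr1.
Qed.

Lemma toC_inj {m n} : injective (fun A : 'M[R]_(m, n) => toC A).
Proof. by move=> A B /matrixP AB; apply/matrixP => i j; have := AB i j;
  rewrite !mxE => -[]. Qed.

(** Orthogonality recovers each slice of [A] up to the factor [l.+1]. Thanks to this, identities
    between tubal matrices are checked on Fourier slices. *)
Lemma dft_inj {m n} : injective (@dft R l m n).
Proof.
move=> A B AB; apply: tubalP => q; apply: toC_inj.
have /(congr1 (fun Y => \sum_k efun k q *: Y k)) := AB.
have key (D : tubalR m n) : \sum_k efun k q *: dft D k = l.+1%:R *: toC (D q).
  under eq_bigr do rewrite dftE scaler_sumr.
  rewrite exchange_big /= -(scale_delta_sum q (fun q => toC (D q))) scaler_sumr.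
  apply: eq_bigr => p _; rewrite scalerA mulrC.
  rewrite -[p - q]opprB oppr_eq0 -sum_efun scaler_suml; apply: eq_bigr => k _.
  by rewrite efunB scalerA.
by rewrite !key => /(scalerI natL_neq0).
Qed.

Lemma dftM {m n s} (A : tubalR m n) (B : tubalR n s) k :
  dft (A ** B) k = dft A k *m dft B k.
Proof.
rewrite !dftE mulmx_sumr.
transitivity (\sum_p \sum_q (efun k p)^* *: (toC (A (p - q)) *m toC (B q))).
  apply: eq_bigr => p _; rewrite tprodE -scaler_sumr; congr (_ *: _).
  by rewrite raddf_sum; apply: eq_bigr => q _; rewrite /= map_mxM.
rewrite exchange_big; apply: eq_bigr => q _ /=.
rewrite (reindex_inj (addIr q)) /= mulmx_suml; apply: eq_bigr => p _.
by rewrite addrK efunD rmorphM -scalemxAl -scalemxAr scalerA.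
Qed.

Lemma trmxC_toC {m n} (A : 'M[R]_(m, n)) : (toC A)^t* = toC A^T.
Proof. by apply/matrixP => i j; rewrite trmxCE !mxE; exact: conjc_real. Qed.

Lemma dft_trmxC {m n} (A : tubalR m n) k :
  (dft A k)^t* = \sum_p efun k p *: toC (A p)^T.
Proof.
rewrite !dftE raddf_sum raddf_sum; apply: eq_bigr => p _ /=.
by rewrite -[LHS]/((_ *: _)^t*) trmxC_scale conjCK trmxC_toC.
Qed.

Lemma dft_ttr {m n} (A : tubalR m n) k : dft (ttr A) k = (dft A k)^t*.
Proof.
rewrite dft_trmxC dftE (reindex_inj oppr_inj) /=; apply: eq_bigr => p _.
by rewrite efunN conjCK /ttr opprK.
Qed.

Lemma dftB {m n} (A B : tubalR m n) k : dft (tsub A B) k = dft A k - dft B k.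
Proof.
by rewrite !dftE -sumrB; apply: eq_bigr => p _; rewrite -scalerBr -map_mxB.
Qed.

Lemma dft_tid n k : dft (tid n : tubalR n n) k = 1%:M.
Proof.
rewrite dftE (bigD1 0)//= big1 ?addr0.
  by rewrite efun0 /tid eqxx rmorph1 scale1r map_mx1.
by move=> p p0; rewrite /tid (negPf p0) map_mx0 scaler0.
Qed.

(** The symmetry by which the method fills the slices that it does not update directly. *)
Lemma dftN {m n} (A : tubalR m n) k : dft A (- k) = map_mx Num.conj (dft A k).
Proof.
rewrite !dftE raddf_sum; apply: eq_bigr => p _ /=.
rewrite map_mxZ efunC efunN -efunC; congr (_ *: _).
by apply/matrixP => i j; rewrite !mxE; apply/esym; exact: conjc_real.
Qed.

(** Conjugate symmetry makes the inverse transform equal to its own conjugate, hence real. Real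
    inverses, pseudo-inverses and square roots are assembled from complex slices in this way. *)
Lemma dft_surj {m n} (Y : tubalC m n) :
  (forall k, Y (- k) = map_mx Num.conj (Y k)) -> exists A : tubalR m n, dft A = Y.
Proof.
move=> YN; exists (fun p => map_mx (@complex.Re R) (idft Y p)).
apply: dft_tcomplex; apply: tubalP => p.
have cY : map_mx Num.conj (idft Y p) = idft Y p.
  rewrite idftE map_mxZ fmorphV rmorph_nat; congr (_ *: _).
  rewrite raddf_sum (reindex_inj oppr_inj) /=; apply: eq_bigr => k _.
  rewrite map_mxZ YN efunC efunN -efunC /= conjCK; congr (_ *: _).
  by apply/matrixP => i j; rewrite !mxE conjCK.
apply/matrixP => i j; rewrite /tcomplex [LHS]mxE [in LHS]mxE.
apply: RRe_real; apply/CrealP.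
by move/matrixP: cY => /(_ i j); rewrite mxE.
Qed.

Lemma parseval {m n} (A B : tubalR m n) :
  \sum_k \tr ((dft A k)^t* *m dft B k) = l.+1%:R * (tinner A B)%:C%C.
Proof.
transitivity (\sum_k \sum_p \sum_q
    efun k (p - q) * \tr (toC (A p)^T *m toC (B q))).
  apply: eq_bigr => k _; rewrite dft_trmxC dftE mulmx_suml raddf_sum.
  apply: eq_bigr => p _; rewrite /= mulmx_sumr raddf_sum;
    apply: eq_bigr => q _ /=.
  by rewrite -scalemxAl -scalemxAr scalerA linearZ /= efunB.
rewrite exchange_big /= tinnerE raddf_sum mulr_sumr; apply: eq_bigr => p _ /=.
rewrite exchange_big /=.
transitivity (\sum_q (q - p == 0)%:R *: (l.+1%:R * \tr (toC (A p)^T *m toC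
  (B q)))).
  apply: eq_bigr => q _; rewrite -mulr_suml sum_efun -[q - p]opprB oppr_eq0.
  by rewrite -[RHS]/(_ * (_ * _)) mulrA.
rewrite (scale_delta_sum p (fun q => l.+1%:R * \tr (toC (A p)^T *m toC (B q)))).
by rewrite -map_mxM trace_map_mx.
Qed.

End FourierTransform.

(** * Real symmetric forms at complex vectors *)

Section RealComplexForms.
Context {R : realType}.
Local Notation C := R[i].
Local Notation toC := (map_mx (real_complex R)).

Lemma toC_sum_cV {n} (y : 'cV[C]_n) :
  y = toC (map_mx (@complex.Re R) y) + ('i :
    C)%C *: toC (map_mx (@complex.Im R) y).
Proof. by apply/matrixP => i j; rewrite !mxE -complexE. Qed.

(** For [y = a + i b] the cross terms are [i (a^T G b - b^T G a)], and they cancel by symmetry of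
    [G]. *)
Lemma quad_toC {n} (G : 'M[R]_n) (y : 'cV[C]_n) : G^T = G ->
  let a := map_mx (@complex.Re R) y in let b := map_mx (@complex.Im R) y in
  (y^t* *m toC G *m y) 0 0 = ((a^T *m G *m a) 0 0 + (b^T *m G *m b) 0 0)%:C%C.
Proof.
move=> Gs a b; rewrite {1 2}(toC_sum_cV y) -/a -/b.
have : Num.conj ('i%C : C) = - 'i%C.
  by apply/eqP; rewrite eq_complex /= oppr0 !eqxx.
have : 'i%C * 'i%C = -1 :> C by rewrite -expr2 sqr_i.
move: ('i%C : C) => j jj jN.
rewrite trmxCD trmxC_scale !trmxC_toC jN.
have ab : (a^T *m G *m b) 0 0 = (b^T *m G *m a) 0 0.
  rewrite -[in LHS](trmxK (a^T *m G *m b)) mxE !trmx_mul trmxK Gs.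
  by rewrite mulmxA.
have DE (A B : 'M[C]_1) : (A + B) 0 0 = A 0 0 + B 0 0 by rewrite mxE.
have ZE (c : C) (A : 'M[C]_1) : (c *: A) 0 0 = c * A 0 0 by rewrite mxE.
have TE (A : 'M[R]_1) : (toC A) 0 0 = (A 0 0)%:C%C by rewrite mxE.
rewrite !(mulmxDl, mulmxDr) -!scalemxAl -!scalemxAr -!map_mxM !DE !ZE !TE ab.
rewrite !mulNr mulrA jj mulN1r opprK.
by rewrite addrA subrK rmorphD.
Qed.

Lemma real_psd_toC {n} {G : 'M[R]_n} : G^T = G ->
  (forall x : 'cV[R]_n, 0 <= (x^T *m G *m x) 0 0) -> psdmx (toC G).
Proof.
move=> Gs G0; split; first by rewrite trmxC_toC Gs.
by move=> y; rewrite quad_toC// ler0c addr_ge0.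
Qed.

Lemma real_pd_toC {n} {G : 'M[R]_n} : G^T = G ->
  (forall x : 'cV[R]_n, x != 0 -> 0 < (x^T *m G *m x) 0 0) ->
  forall y : 'cV[C]_n, y != 0 -> 0 < (y^t* *m toC G *m y) 0 0.
Proof.
move=> Gs G0 y y0; rewrite quad_toC//.
have Gge0 (x : 'cV[R]_n) : 0 <= (x^T *m G *m x) 0 0.
  by have [->|/G0/ltW//] := eqVneq x 0; rewrite mulmx0 mxE.
rewrite (_ : 0 = (0 : R)%:C%C)// ltcR.
have [a0|a0] := eqVneq (map_mx (@complex.Re R) y) 0; last first.
  by rewrite ltr_pwDl// G0.
have [b0|b0] := eqVneq (map_mx (@complex.Im R) y) 0; last first.
  by rewrite ltr_wpDl// G0.
by case/eqP: y0; rewrite (toC_sum_cV y) a0 b0 !map_mx0 scaler0 addr0.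
Qed.

End RealComplexForms.

(** * From T-positivity to positivity of the Fourier slices *)

Section TubalForms.
Context {R : realType} {l : nat}.
Local Notation C := R[i].
Local Notation tubalR := (tubal R l).
Local Notation tubalC := (tubal C l).
Local Notation toC := (map_mx (real_complex R)).

Lemma tfoldK {K : pzRingType} {m n} : cancel (@tfold K l m n) (@tunfold K l m n).
Proof. by move=> A; rewrite /tunfold /tfold submxcolK. Qed.

Lemma bcirc_tunfold {K : pzRingType} {m n s} (A : tubal K l m n) (B :
  tubal K l n s) :
  bcirc A *m tunfold B = tunfold (A ** B).
Proof. by rewrite tfoldK. Qed.

Lemma tinner_tprod {n} (X : tubalR n 1) (M : tubalR n n) :
  tinner X (M ** X) = ((tunfold X)^T *m bcirc M *m tunfold X) 0 0.
Proof.
rewrite -mulmxA bcirc_tunfold tinnerE /tunfold tr_mxcol mul_mxrow_mxcol summxE.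
by apply: eq_bigr => k _; rewrite /mxtrace big_ord1.
Qed.

(** [y] is [x] modulated by a character. A block circulant matrix sends it to the modulation of
    [dft M k *m x]; the unimodular factors cancel in the form and every block contributes the same
    amount. Positivity thus passes from [bcirc M] to each slice. *)
Lemma quad_bcirc_dft {n} (M : tubalR n n) k (x : 'cV[C]_n) :
  let y := \mxcol_(p < l.+1) (efun k p *: x) in
  (y^t* *m toC (bcirc M) *m y) 0 0 = l.+1%:R * (x^t* *m dft M k *m x) 0 0.
Proof.
pose Y : tubalC n 1 := fun p => efun k p *: x.
rewrite -[\mxcol_p _]/(tunfold Y) /=.
have -> : toC (bcirc M) = bcirc (tcomplex M).
  by apply/matrixP => i j; rewrite !mxE.
have MY p : (tcomplex M ** Y) p = efun k p *: (dft M k *m x).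
  rewrite tprodE (reindex_inj (inj_comp (addrI p) oppr_inj)) /= dftE.
  rewrite mulmx_suml scaler_sumr; apply: eq_bigr => q _.
  by rewrite subKr /Y /tcomplex efunB -scalemxAr -scalemxAl scalerA.
rewrite -mulmxA bcirc_tunfold.
have -> : (tunfold Y)^t* = \mxrow_p (Y p)^t*.
  by apply/matrixP => i j; rewrite !mxE.
rewrite mul_mxrow_mxcol summxE.
under eq_bigr do rewrite MY trmxC_scale -scalemxAl -scalemxAr scalerA mulrC efunJ
  scale1r.
by rewrite sumr_const card_ord -mulmxA mulr_natl.
Qed.

(** The semidefinite weakening of [T_posdef], which also covers square roots and averaged
    projections. *)
Definition tsym_psd {n} (M : tubalR n n) :=
  M = ttr M /\ forall X : tubalR n 1, 0 <= tinner X (M ** X).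

Lemma bcirc_sym {n} {M : tubalR n n} : M = ttr M -> (bcirc M)^T = bcirc M.
Proof. by move=> {2}->; rewrite bcirc_ttr. Qed.

Lemma tsym_psd_bcirc {n} {M : tubalR n n} : tsym_psd M ->
  forall x : 'cV[R]_(\sum_(p < l.+1) n), 0 <= (x^T *m bcirc M *m x) 0 0.
Proof. by move=> [_ M0] x; rewrite -(tfoldK x) -tinner_tprod. Qed.

Lemma tsym_psd_dft {n} {M : tubalR n n} k : tsym_psd M -> psdmx (dft M k).
Proof.
move=> Mp; have Ms := Mp.1; split; first by rewrite -dft_ttr -Ms.
move=> x; have := (real_psd_toC (bcirc_sym Ms) (tsym_psd_bcirc Mp)).2.
move=> /(_ (\mxcol_(p < l.+1) (efun k p *: x))); rewrite quad_bcirc_dft.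
by rewrite pmulr_rge0// ltr0n.
Qed.

Lemma T_posdef_psd {n} {M : tubalR n n} : T_posdef M -> tsym_psd M.
Proof.
move=> [Ms M0]; split=> // X.
have [->|/eqP/M0/ltW//] := eqVneq X tzero.
by rewrite tinnerE; apply: sumr_ge0 => k _; rewrite trmx0 mul0mx mxtrace0.
Qed.

(** A nonzero kernel vector of the slice, modulated by a character, would be a nonzero vector on
    which the positive definite form of [bcirc M] vanishes. *)
Lemma T_posdef_dft_unit {n} {M : tubalR n n} k : T_posdef M -> dft M k \in unitmx.
Proof.
move=> [Ms M0].
have bpd (x : 'cV[R]_(\sum_(p < l.+1) n)) : x != 0 ->
  0 < (x^T *m bcirc M *m x) 0 0.
  move=> x0; rewrite -(tfoldK x) -tinner_tprod; apply: M0 => x0'.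
  case/eqP: x0; rewrite -(tfoldK x) x0' /tunfold.
  by apply/matrixP => i j; rewrite !mxE.
rewrite -unitmx_tr -row_free_unit; apply: inj_row_free => v.
move=> /(congr1 trmx); rewrite trmx_mul trmxK trmx0 => Mv.
have [->//|v0] := eqVneq v 0.
have := real_pd_toC (bcirc_sym Ms) bpd (\mxcol_(p < l.+1) (efun k p *: v^T)).
rewrite quad_bcirc_dft -mulmxA Mv mulmx0 mxE mulr0 ltxx => H.
suff: false by []; apply: H.
apply: contra v0 => /eqP/(congr1 (fun U => submxcol U 0)).
by rewrite mxcolK submxcol0 efun0 scale1r -trmx0 => /trmx_inj ->.
Qed.

End TubalForms.

(** * Inverses and square roots of tubal matrices *)

Section SliceInverses.
Context {R : realType} {l : nat}.
Local Notation C := R[i].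
Local Notation tubalR := (tubal R l).
Local Notation toC := (map_mx (real_complex R)).

Lemma mxpinvP {n} {A : 'M[C]_n} : A^t* = A -> penrose A (mxpinv A).
Proof. by move=> /penrose_exists AX; have := xgetPex 0 AX. Qed.

Lemma penrose_conj {m n} {A : 'M[C]_(m, n)} {X : 'M[C]_(n, m)} :
  penrose A X -> penrose (map_mx Num.conj A) (map_mx Num.conj X).
Proof.
have cJ p q (B : 'M[C]_(p, q)) : (map_mx Num.conj B)^t* = map_mx Num.conj (B^t*).
  by apply/matrixP => i j; rewrite !mxE.
by move=> [AX XA AXh XAh]; split; rewrite -!map_mxM ?cJ ?AX ?XA ?AXh ?XAh.
Qed.

Lemma tinvP {n} {A : tubalR n n} : (forall k, dft A k \in unitmx) ->
  forall k, dft (tinv A) k = invmx (dft A k).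
Proof.
move=> Au.
have [X XE] : exists X : tubalR n n, dft X = fun k => invmx (dft A k).
  by apply: dft_surj => k; rewrite dftN map_invmx.
have [] : [set X | A ** X = tid n /\ X ** A = tid n] (tinv A).
  apply: xgetPex; exists X; split; apply: dft_inj; apply: tubalP => k.
    by rewrite dftM XE dft_tid mulmxV.
  by rewrite dftM XE dft_tid mulVmx.
move=> AX _ k; have := congr1 (fun Y => dft Y k) AX.
by rewrite /= dftM dft_tid => /(congr1 (mulmx (invmx (dft A k))));
  rewrite mulKmx// mulmx1.
Qed.

(** Conjugation preserves the Penrose equations, and these have one solution; so the slicewise
    pseudo-inverses have the symmetry of a real tubal matrix. That matrix shows that the choice made
    by [tpinv] is not the default value. *)
Lemma tpinvP {n} {A : tubalR n n} : ttr A = A ->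
  A ** tpinv A ** A = A /\ forall k, penrose (dft A k) (dft (tpinv A) k).
Proof.
move=> As.
have Ah k : (dft A k)^t* = dft A k by rewrite -dft_ttr As.
have [X XE] : exists X : tubalR n n, dft X = fun k => mxpinv (dft A k).
  apply: dft_surj => k; apply: penrose_unique (penrose_conj (mxpinvP (Ah k))).
  by rewrite -dftN; apply: mxpinvP.
have [] : [set X | [/\ A ** X ** A = A, X ** A ** X = X,
    ttr (A ** X) = A ** X & ttr (X ** A) = X ** A]] (tpinv A).
  apply: xgetPex; exists X.
  split; apply: dft_inj; apply: tubalP => k; have [? ? ? ?] := mxpinvP (Ah k);
  by rewrite ?dft_ttr !dftM XE.
move=> AX XA AXs XAs; split=> // k; split.
- by rewrite -!dftM AX.
- by rewrite -!dftM XA.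
- by rewrite -!dftM -dft_ttr AXs.
- by rewrite -!dftM -dft_ttr XAs.
Qed.

Lemma tpinvE {n} {A : tubalR n n} k : ttr A = A ->
  dft (tpinv A) k = mxpinv (dft A k).
Proof.
move=> As; apply: penrose_unique ((tpinvP As).2 k) (mxpinvP _).
by rewrite -dft_ttr As.
Qed.

Lemma psdmx_conj {n} {A : 'M[C]_n} : psdmx A -> psdmx (map_mx Num.conj A).
Proof.
move=> [Ah A0]; split.
  by rewrite -[in RHS]Ah; apply/matrixP => i j; rewrite !mxE.
move=> x; rewrite -[_ 0 0]conjCK conjC_ge0.
have := A0 (map_mx Num.conj x); congr (_ <= _).
have e p q (B : 'M[C]_(p, q)) i j : Num.conj (B i j) = (map_mx Num.conj B) i j.
  by rewrite mxE.
rewrite e !map_mxM; congr ((_ *m _ *m _) 0 0).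
  by apply/matrixP => i j; rewrite !mxE.
by apply/matrixP => i j; rewrite !mxE /= conjCK.
Qed.

Lemma tinner_ge0 {m n} (X : tubalR m n) : 0 <= tinner X X.
Proof. by do 3!(apply: sumr_ge0 => ? _); rewrite -expr2 sqr_ge0. Qed.

(** Two real semidefinite roots of one matrix are compared as complex matrices, where the root is
    unique. *)
Lemma mxsqrt_bcirc {n} (Q : tubalR n n) : tsym_psd Q ->
  mxsqrt (bcirc (Q ** Q)) = bcirc Q.
Proof.
move=> Qp; have Qs := bcirc_sym Qp.1.
apply: xget_unique; first split=> //.
- exact: tsym_psd_bcirc.
- by rewrite bcircM.
move=> P [Ps P0 PP]; apply: toC_inj; apply: psd_sqrt_unique.
- exact: real_psd_toC.
- by apply: real_psd_toC => //; exact: tsym_psd_bcirc.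
- by rewrite -!map_mxM PP bcircM.
Qed.

Lemma dft_psd_tsym {n} (Q : tubalR n n) :
  (forall k, psdmx (dft Q k)) -> tsym_psd Q.
Proof.
move=> Qp; split.
  by apply: dft_inj; apply: tubalP => k; rewrite dft_ttr (Qp k).1.
move=> X; rewrite -ler0c -(pmulr_rge0 (x := l.+1%:R)) ?ltr0n// -parseval.
apply: sumr_ge0 => k _; rewrite dftM mulmxA; exact: psd_mxtrace_ge0.
Qed.

(** The definition of [tsqrt] presupposes that the root of [bcirc M] is block circulant. It is:
    roots of the slices assemble into a real [Q], and [bcirc Q] is the semidefinite root by
    uniqueness. *)
Lemma tsqrtP {n} {M : tubalR n n} : tsym_psd M ->
  tsym_psd (tsqrt M) /\ tsqrt M ** tsqrt M = M.
Proof.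
move=> Mp; have [Y YP] := choice (fun k => psd_sqrt _ _ (tsym_psd_dft k Mp)).
have [Q QE] : exists Q : tubalR n n, dft Q = Y.
  apply: dft_surj => k; apply: psd_sqrt_unique.
  - exact: (YP _).1.
  - exact: psdmx_conj (YP _).1.
  - by rewrite -map_mxM !(YP _).2 dftN.
have Qp : tsym_psd Q by apply: dft_psd_tsym => k; rewrite QE; exact: (YP _).1.
have QQ : Q ** Q = M.
  by apply: dft_inj; apply: tubalP => k; rewrite dftM QE (YP k).2.
suff -> : tsqrt M = Q by [].
apply: xget_unique => [|X]; rewrite /= -QQ mxsqrt_bcirc//.
exact: bcirc_inj.
Qed.

End SliceInverses.

(** * Lower bounds by the smallest eigenvalue *)

Section SmallestEigenvalue.
Context {R : realType}.
Local Notation C := R[i].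

Lemma eigenvalue_diag {n} {U A : 'M[C]_n} {d : 'rV[C]_n} {a : C} :
  U *m U^t* = 1%:M -> U^t* *m U = 1%:M -> A = U^t* *m diag_mx d *m U ->
  eigenvalue A a <-> exists i, a = d 0 i.
Proof.
move=> UU UU' AE; split.
  move=> /eigenvalueP[v vA v0]; pose u := v *m U^t*.
  have u0 : u != 0.
    by apply: contra v0 => /eqP u0; rewrite -[v]mulmx1 -UU' mulmxA -/u u0 mul0mx.
  have ud : u *m diag_mx d = a *: u.
    by rewrite /u scalemxAl -vA AE !mulmxA -[RHS]mulmxA UU mulmx1.
  have [i ui] : exists i, u 0 i != 0.
    apply/existsP; apply: contraNT u0; rewrite negb_exists => /forallP u0.
    by apply/eqP/rowP => i; rewrite [RHS]mxE; apply/eqP; move: (u0 i);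
      rewrite negbK.
  exists i; have /rowP/(_ i) := ud; rewrite mul_mx_diag [LHS]mxE [RHS]mxE mulrC.
  by move=> e; apply/esym/(mulIf ui).
move=> [i ->]; apply/eigenvalueP; exists (row i U).
  rewrite -row_mul AE !mulmxA UU mul1mx mul_diag_mx.
  by apply/rowP => j; rewrite !mxE.
apply/eqP => U0; have /matrixP/(_ i i) := UU.
rewrite [RHS]mxE eqxx mxE big1 => [/eqP|j _]; first by rewrite eq_sym oner_eq0.
by move/rowP: U0 => /(_ j); rewrite !mxE => ->; rewrite mul0r.
Qed.

Lemma lambda_min_ge0 {n} {A : 'M[C]_n} : psdmx A -> 0 <= lambda_min A.
Proof.
move=> [Ah A0]; have [U [d [UU UU' dr AE]]] := hermitian_diag Ah.
(* An empty spectrum occurs for [n = 0]; the infimum is then 0. *)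
rewrite /lambda_min; have [->|/set0P E0] := eqVneq [set a :
  R | eigenvalue A a%:C%C] set0.
  by rewrite inf0.
apply: lb_le_inf => // a /= /(eigenvalue_diag UU UU' AE)[i ai].
by rewrite -ler0c ai; exact: (psdmx_diag UU AE A0).
Qed.

Lemma lambda_min_le {n} {A : 'M[C]_n} {U : 'M[C]_n} {d : 'rV[C]_n} i :
  U *m U^t* = 1%:M -> U^t* *m U = 1%:M -> (forall j, (d 0 j)^* = d 0 j) ->
  A = U^t* *m diag_mx d *m U -> (lambda_min A)%:C%C <= d 0 i.
Proof.
move=> UU UU' dr AE.
have dE j : d 0 j = (complex.Re (d 0 j))%:C%C by rewrite RRe_real//; apply/CrealP.
rewrite dE lecR; apply: ge_inf; last first.
  by apply/(eigenvalue_diag UU UU' AE); exists i; rewrite -dE.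
(* A crude lower bound of the spectrum: [inf] is known to lie below the elements once the set is
   bounded below. *)
exists (- \sum_j `|complex.Re (d 0 j)|) => a /= /(eigenvalue_diag UU UU' AE)[j].
rewrite dE => -[->]; rewrite lerNl (le_trans (ler_norm _))// normrN.
by rewrite (bigD1 j)//= lerDl sumr_ge0.
Qed.

Lemma lambda_min_quad {m n} {A : 'M[C]_n} (X : 'M[C]_(n, m)) : A^t* = A ->
  (lambda_min A)%:C%C * \tr (X^t* *m X) <= \tr (X^t* *m A *m X).
Proof.
move=> Ah; have [U [d [UU UU' dr AE]]] := hermitian_diag Ah.
set c := (lambda_min A)%:C%C.
have cr : c^* = c by apply/CrealP/complex_realP; exists (lambda_min A).
have dc i : c <= d 0 i by exact: lambda_min_le UU UU' dr AE.
have AcE : A - c%:M = U^t* *m diag_mx (d - const_mx c) *m U.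
  rewrite linearB /= mulmxBr mulmxBl -AE diag_const_mx mul_mx_scalar.
  by rewrite -scalemxAl UU' scalemx1.
have Acp : psdmx (A - c%:M).
  split; first by rewrite trmxCB Ah tr_scalar_mx map_scalar_mx /= cr.
  move=> x; rewrite (quad_diag x AcE); apply: sumr_ge0 => i _.
  by rewrite mulr_ge0 ?exprn_ge0// !mxE subr_ge0.
have := psd_mxtrace_ge0 X Acp.
rewrite mulmxBr mulmxBl linearB /= subr_ge0.
by rewrite mul_mx_scalar -scalemxAl linearZ.
Qed.

(** With [Q = T T], the right side is the form of [P] at [E T], hence at least [lambda_min P] times
    the squared norm of [E T]; that norm is in turn the form of [Q] at the adjoint of [E]. Chaining
    the two bounds uses [0 <= lambda_min P]. *)
Lemma lambda_min_mulmx {r s} {P : 'M[C]_r} {Q : 'M[C]_s} (E : 'M[C]_(r, s)) :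
  psdmx P -> psdmx Q ->
  (lambda_min P * lambda_min Q)%:C%C * \tr (E^t* *m E) <=
  \tr (E^t* *m (P *m E *m Q)).
Proof.
move=> Pp Qp; have [T [[Th _] TT]] := psd_sqrt _ _ Qp.
have -> : \tr (E^t* *m (P *m E *m Q)) = \tr ((E *m T)^t* *m P *m (E *m T)).
  by rewrite -TT trmxC_mul Th -!mulmxA [RHS]mxtrace_mulC !mulmxA.
apply: le_trans (lambda_min_quad _ Pp.1).
rewrite rmorphM -mulrA ler_wpM2l ?ler0c ?lambda_min_ge0//.
have -> : \tr ((E *m T)^t* *m (E *m T)) = \tr (E^t*^t* *m Q *m E^t*).
  by rewrite -TT trmxC_mul Th trmxCK mxtrace_mulC !mulmxA.
rewrite mxtrace_mulC -[E in \tr (E *m _)]trmxCK.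
exact: lambda_min_quad Qp.1.
Qed.

End SmallestEigenvalue.

(** * The real inner product of tubal matrices *)

Section TubalInner.
Context {R : realType} {l : nat}.
Local Notation C := R[i].
Local Notation tubalR := (tubal R l).

Lemma tinner_inj_dft {m n p q} (A B : tubalR m n) (D E : tubalR p q) :
  (forall k, \tr ((dft A k)^t* *m dft B k) = \tr ((dft D k)^t* *m dft E k)) ->
  tinner A B = tinner D E.
Proof.
move=> e; apply: (@complexI R); apply: (mulfI (@natL_neq0 R l)).
by rewrite -!parseval; apply: eq_bigr.
Qed.

Lemma tinner_mull {m n p} (A : tubalR m n) (X : tubalR n p) (Y : tubalR m p) :
  tinner (A ** X) Y = tinner X (ttr A ** Y).
Proof.
apply: tinner_inj_dft => k.
by rewrite !dftM dft_ttr trmxC_mul mulmxA.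
Qed.

Lemma tinner_mulr {m n p} (B : tubalR n p) (X : tubalR m n) (Y : tubalR m p) :
  tinner (X ** B) Y = tinner X (Y ** ttr B).
Proof.
apply: tinner_inj_dft => k.
by rewrite !dftM dft_ttr trmxC_mul -mulmxA mxtrace_mulC mulmxA.
Qed.

Lemma tinnerBl {m n} (A B D : tubalR m n) :
  tinner (tsub A B) D = tinner A D - tinner B D.
Proof.
rewrite !tinnerE -sumrB; apply: eq_bigr => k _.
by rewrite /tsub linearB /= mulmxBl linearB.
Qed.

Lemma tinnerC {m n} (A B : tubalR m n) : tinner A B = tinner B A.
Proof.
by do 3!(apply: eq_bigr => ? _); rewrite mulrC.
Qed.

Lemma tinner_lambda_min {r s} (P : tubalR r r) (Q : tubalR s s) (E :
  tubalR r s) c :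
  (forall k, psdmx (dft P k)) -> (forall k, psdmx (dft Q k)) ->
  (forall k, c <= lambda_min (dft P k) * lambda_min (dft Q k)) ->
  c * tinner E E <= tinner E (P ** E ** Q).
Proof.
move=> Pp Qp cPQ; rewrite -lecR -(ler_pM2l (x := l.+1%:R)) ?ltr0n//.
rewrite rmorphM mulrCA -!parseval mulr_sumr; apply: ler_sum => k _.
apply: (@le_trans _ _ ((lambda_min (dft P k) * lambda_min (dft Q k))%:C%C *
  \tr ((dft E k)^t* *m dft E k))).
  by rewrite ler_wpM2r ?mxtrace_sqr_ge0// lecR.
by rewrite !dftM lambda_min_mulmx.
Qed.

(** Sending [E] to [P ** E ** Q] is an orthogonal projection, so [D] and [E - D] are orthogonal and
    Pythagoras applies. *)
Lemma tinner_proj {r s} (P : tubalR r r) (Q : tubalR s s) (E : tubalR r s) :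
  ttr P = P -> P ** P = P -> ttr Q = Q -> Q ** Q = Q ->
  let D := P ** E ** Q in
  tinner (tsub E D) (tsub E D) = tinner E E - tinner E D.
Proof.
move=> Ps PP Qs QQ D.
have DD : tinner D D = tinner E D.
  by rewrite {1}/D tinner_mulr tinner_mull Ps Qs /D !tprodA PP -(tprodA _ Q Q) QQ.
by rewrite tinnerBl ![tinner _ (tsub _ _)]tinnerC !tinnerBl DD [tinner D
  E]tinnerC subrr subr0.
Qed.

Lemma sqnormFE {r s} (M : tubalR r r) (N : tubalR s s) (X : tubalR r s) :
  tsym_psd M -> tsym_psd N ->
  sqnormF M N X = tinner (tsqrt M ** X ** tsqrt N) (tsqrt M ** X ** tsqrt N).
Proof.
move=> Mp Np; have [[Ms _] MM] := tsqrtP Mp; have [[Ns _] NN] := tsqrtP Np.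
rewrite /sqnormF tkron_vect tinner_vect tinner_mulr tinner_mull -Ms -Ns.
by rewrite !tprodA MM -(tprodA _ (tsqrt N)) NN tinnerC.
Qed.

End TubalInner.

(** * Sketched projections and the error recursion *)

Lemma invmx_mul {F : comUnitRingType} {n} (A B : 'M[F]_n) :
  A \in unitmx -> B \in unitmx -> invmx (A *m B) = invmx B *m invmx A.
Proof.
move=> Au Bu; have ABu : A *m B \in unitmx by rewrite unitmx_mul Au.
rewrite -[RHS]mulmx1 -(mulmxV ABu) !mulmxA -(mulmxA (invmx B)) mulVmx//.
by rewrite mulmx1 mulVmx// mul1mx.
Qed.

(** Here [K] and [L] stand for slices of the roots of [M] and [N], and [A'], [B'] for adjoints.
    Multiplying the update by [K] and [L] cancels one inverse root on each outer side, and the error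
    [K D L] appears in the middle. *)
Lemma preconditioned_slice {F : comUnitRingType} {m n r s} (K : 'M[F]_r)
    (L : 'M[F]_s) (A : 'M[F]_(m, r)) (A' : 'M[F]_(r, m)) (B : 'M[F]_(s, n))
    (B' : 'M[F]_(n, s)) (E : 'M[F]_m) (G : 'M[F]_n) (D : 'M[F]_(r, s)) :
  K \in unitmx -> L \in unitmx ->
  K *m (invmx K *m invmx K *m A' *m E *m (A *m D *m B) *m G *m B' *m
    (invmx L *m invmx L)) *m L =
  invmx K *m A' *m E *m A *m invmx K *m (K *m D *m L) *m
    (invmx L *m B *m G *m B' *m invmx L).
Proof.
move=> Ku Lu; rewrite !mulmxA mulmxV// mul1mx mulmxKV//.
by rewrite mulmxKV// mulmxK.
Qed.

Section GramProjection.
Context {R : realType} {l : nat}.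
Local Notation tubalR := (tubal R l).

Lemma tpinv_sym {n} (D : tubalR n n) : ttr D = D -> ttr (tpinv D) = tpinv D.
Proof.
move=> Ds; apply: dft_inj; apply: tubalP => k; rewrite dft_ttr.
by apply: penrose_hermitian ((tpinvP Ds).2 k); rewrite -dft_ttr Ds.
Qed.

Context {r tau : nat} (Q : tubalR r tau).

Lemma gram_sym : ttr (ttr Q ** Q) = ttr Q ** Q.
Proof. by rewrite ttrM ttrK. Qed.

(** The orthogonal projection onto the range of [Q]. *)
Definition gram_proj := Q ** tpinv (ttr Q ** Q) ** ttr Q.

Lemma gram_proj_sym : ttr gram_proj = gram_proj.
Proof. by rewrite !ttrM ttrK (tpinv_sym _ gram_sym) tprodA. Qed.

Lemma gram_proj_idem : gram_proj ** gram_proj = gram_proj.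
Proof.
apply: dft_inj; apply: tubalP => k; rewrite !dftM.
have [_ + _ _] := (tpinvP gram_sym).2 k; rewrite dftM => PP.
by rewrite -[in RHS]PP !mulmxA.
Qed.

End GramProjection.

Section SketchProjection.
Context {R : realType} {l m r : nat}.
Local Notation C := R[i].
Local Notation tubalR := (tubal R l).
Variables (A : tubalR m r) (M : tubalR r r).
Hypothesis Mp : T_posdef M.

Let Mpsd : tsym_psd M := T_posdef_psd Mp.

Lemma tsqrt_sym : ttr (tsqrt M) = tsqrt M.
Proof. by have [[<-]] := tsqrtP Mpsd. Qed.

Lemma dft_tsqrtM k : dft (tsqrt M) k *m dft (tsqrt M) k = dft M k.
Proof. by rewrite -dftM (tsqrtP Mpsd).2. Qed.

Lemma dft_tsqrt_unit k : dft (tsqrt M) k \in unitmx.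
Proof.
have := T_posdef_dft_unit k Mp.
by rewrite -dft_tsqrtM unitmx_mul andbb.
Qed.

Lemma dft_tsqrt_herm k : (dft (tsqrt M) k)^t* = dft (tsqrt M) k.
Proof. by rewrite -dft_ttr tsqrt_sym. Qed.

Lemma dft_tinv_tsqrt k : dft (tinv (tsqrt M)) k = invmx (dft (tsqrt M) k).
Proof. exact/tinvP/dft_tsqrt_unit. Qed.

Lemma tinv_tsqrt_sym : ttr (tinv (tsqrt M)) = tinv (tsqrt M).
Proof.
apply: dft_inj; apply: tubalP => k.
by rewrite dft_ttr dft_tinv_tsqrt trmxC_inv dft_tsqrt_herm.
Qed.

Lemma tinv_tsqrtM : tinv (tsqrt M) ** tinv (tsqrt M) = tinv M.
Proof.
apply: dft_inj; apply: tubalP => k; rewrite dftM dft_tinv_tsqrt.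
rewrite tinvP => [|j]; last exact: T_posdef_dft_unit.
by rewrite -[in RHS]dft_tsqrtM invmx_mul ?dft_tsqrt_unit.
Qed.

Section Sketch.
Context {tau : nat} (S : tubalR m tau).

(** Splitting [M^-1] into two roots exhibits the matrix under the pseudo-inverse as the Gram matrix
    of this factor. *)
Definition sketch_factor : tubalR r tau := tinv (tsqrt M) ** ttr A ** S.

Local Notation Q := sketch_factor.

Lemma sketch_gram : ttr S ** A ** tinv M ** ttr A ** S = ttr Q ** Q.
Proof.
by rewrite /sketch_factor !ttrM ttrK tinv_tsqrt_sym -tinv_tsqrtM !tprodA.
Qed.

Lemma ZprojE : Zproj A M S = gram_proj Q.
Proof.
rewrite /gram_proj /Zproj sketch_gram /sketch_factor !ttrM ttrK tinv_tsqrt_sym.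
by rewrite !tprodA.
Qed.

Lemma Zproj_sym : ttr (Zproj A M S) = Zproj A M S.
Proof. by rewrite ZprojE gram_proj_sym. Qed.

Lemma Zproj_idem : Zproj A M S ** Zproj A M S = Zproj A M S.
Proof. by rewrite ZprojE gram_proj_idem. Qed.

Lemma dft_ZprojE k : dft (Zproj A M S) k =
  invmx (dft (tsqrt M) k) *m (dft A k)^t* *m Ehat A M S k *m dft A k
    *m invmx (dft (tsqrt M) k).
Proof.
rewrite /Zproj /Ehat !dftM !dft_ttr dft_tinv_tsqrt tpinvE; last first.
  by rewrite sketch_gram gram_sym.
rewrite !dftM !dft_ttr tinvP ?mulmxA// => j; exact: T_posdef_dft_unit.
Qed.

End Sketch.
End SketchProjection.

Definition weighted_err {R : realType} {l r s} (M : tubal R l r r)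
    (N : tubal R l s s) (Xstar X : tubal R l r s) : tubal R l r s :=
  tsqrt M ** tsub X Xstar ** tsqrt N.

Section ErrorRecursion.
Context {R : realType} {l m n r s : nat}.
Local Notation C := R[i].
Local Notation tubalR := (tubal R l).
Context {A : tubalR m r} {B : tubalR s n} {Cc : tubalR m n}.
Context {M : tubalR r r} {N : tubalR s s} {Xstar : tubalR r s}.
Hypotheses (Mp : T_posdef M) (Np : T_posdef N) (AXB : A ** Xstar ** B = Cc).

(** The right sketch is a left sketch for [ttr B] and the weight [N], so all properties of [Zproj]
    carry over. *)
Lemma WprojE zeta (V : tubalR n zeta) : Wproj B N V = Zproj (ttr B) N V.
Proof. by rewrite /Wproj /Zproj ttrK. Qed.

Lemma GhatE zeta (V : tubalR n zeta) k : Ghat B N V k = Ehat (ttr B) N V k.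
Proof. by rewrite /Ghat /Ehat dft_ttr trmxCK. Qed.

Local Notation werr := (weighted_err M N Xstar).

Lemma tesp_slice_err tau zeta (S : tubalR m tau) (V : tubalR n zeta) X k :
  dft (tsqrt M) k *m (tesp_slice A B Cc M N S V (dft X) k - dft Xstar k)
    *m dft (tsqrt N) k =
  dft (tsub (werr X) (Zproj A M S ** werr X ** Wproj B N V)) k.
Proof.
have [MM NN] := (dft_tsqrtM _ Mp k, dft_tsqrtM _ Np k).
have [Mu Nu] := (dft_tsqrt_unit _ Mp k, dft_tsqrt_unit _ Np k).
rewrite WprojE dftB (dftM (_ ** werr X)) (dftM (Zproj A M S)).
rewrite !dft_ZprojE// dft_ttr trmxCK -GhatE /weighted_err !dftM dftB.
rewrite /tesp_slice -AXB !dftM.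
move: (dft (tsqrt M) k) (dft (tsqrt N) k) (dft M k) (dft N k) MM NN Mu Nu.
move=> K L _ _ <- <- Mu Nu.
rewrite !invmx_mul// -mulmxBl -mulmxBr.
set D := dft X k - dft Xstar k.
rewrite addrAC -/D mulmxBr mulmxBl; congr (_ - _).
exact: preconditioned_slice.
Qed.

Lemma tesp_step_err tau zeta (S : tubalR m tau) (V : tubalR n zeta) X X' :
  tcomplex X' = idft (tesp_step A B Cc M N S V (dft X)) ->
  werr X' = tsub (werr X) (Zproj A M S ** werr X ** Wproj B N V).
Proof.
move=> /dft_tcomplex X'E; apply: dft_inj; apply: tubalP => k.
rewrite {1}/weighted_err !dftM dftB X'E /tesp_step; case: ifP => _.
  exact: tesp_slice_err.
(* The slice identity holds at every index; for a slice filled by conjugation it is used at [- k]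
   and conjugated. *)
have cN p q (Y : tubalR p q) : dft Y k = map_mx Num.conj (dft Y (- k)).
  by rewrite -dftN opprK.
rewrite [RHS]cN -tesp_slice_err !map_mxM [X in _ = _ *m X *m _]map_mxB.
by rewrite -(cN _ _ (tsqrt M)) -(cN _ _ (tsqrt N)) -(cN _ _ Xstar).
Qed.

End ErrorRecursion.

(** * Measurability of the sketched projections *)

Section GramLimit.
Context {R : realType}.

(** Tikhonov regularisation: for [c >= 0] this is invertible whatever the rank of [Q], and its
    inverse is a rational function of the entries of [Q]. *)
Definition ridge {r t} (Q : 'M[R]_(r, t)) (c : R) : 'M[R]_r :=
  1%:M + c *: (Q *m Q^T).

Lemma mulmx_tr_diag {m n} (A : 'M[R]_(m, n)) i :
  (A *m A^T) i i = \sum_j A i j ^+ 2.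
Proof. by rewrite mxE; apply: eq_bigr => j _; rewrite mxE expr2. Qed.

Lemma mulmx_tr_eq0 {m n} (A : 'M[R]_(m, n)) : A *m A^T = 0 -> A = 0.
Proof.
move=> A0; apply/matrixP => i j; rewrite mxE; apply/eqP; rewrite -sqrf_eq0.
have := congr1 (fun B : 'M[R]_m => B i i) A0.
rewrite mulmx_tr_diag mxE => /psumr_eq0P-> // k _; exact: sqr_ge0.
Qed.

Lemma ridge_unit {r t} (Q : 'M[R]_(r, t)) c : 0 <= c -> ridge Q c \in unitmx.
Proof.
move=> c0; rewrite -row_free_unit; apply: inj_row_free => v.
rewrite mulmxDr mulmx1 -scalemxAr => /(congr1 (mulmx^~ v^T)).
rewrite mulmxDl mul0mx -scalemxAl mulmxA -(mulmxA (v *m Q)).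
rewrite -trmx_mul => vv.
have := congr1 (fun B : 'M[R]_1 => B 0 0) vv.
have e (A B : 'M[R]_1) : (A + c *: B) 0 0 = A 0 0 + c * B 0 0 by rewrite !mxE.
rewrite e !mulmx_tr_diag [RHS]mxE => /eqP.
have ge0 n (u : 'rV[R]_n) : 0 <= \sum_j u 0 j ^+ 2.
  by apply: sumr_ge0 => j _; exact: sqr_ge0.
rewrite paddr_eq0 ?mulr_ge0// => /andP[/eqP/psumr_eq0P v0 _].
apply/rowP => j; rewrite mxE; apply/eqP; rewrite -sqrf_eq0 v0// => k _.
exact: sqr_ge0.
Qed.

Lemma ridge_sym {r t} (Q : 'M[R]_(r, t)) c :
  (invmx (ridge Q c))^T = invmx (ridge Q c).
Proof. by rewrite trmx_inv linearD linearZ /= trmx1 trmx_mul trmxK. Qed.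

(** With [W] the inverse, [c (W Q) (W Q)^T = W - W W^T]. A diagonal entry on the right is at most
    [W i i - W i i ^+ 2], hence at most 1; so the entries of [W Q] decay like [c^(-1/2)]. *)
Lemma ridge_mul_le {r t} (Q : 'M[R]_(r, t)) c i j : 0 <= c ->
  c * ((invmx (ridge Q c) *m Q) i j) ^+ 2 <= 1.
Proof.
move=> c0; set W := invmx _.
have Wu := ridge_unit Q c c0.
have WW : c *: ((W *m Q) *m (W *m Q)^T) = W - W *m W^T.
  have Ws : W^T = W := ridge_sym Q c.
  have cG : c *: (Q *m Q^T) = ridge Q c - 1%:M by rewrite /ridge addrC addKr.
  transitivity (W *m (c *: (Q *m Q^T)) *m W).
    by rewrite -scalemxAr -scalemxAl trmx_mul Ws !mulmxA.
  by rewrite cG mulmxBr mulmxBl mulVmx// mul1mx mulmx1 Ws.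
have := congr1 (fun B : 'M[R]_r => B i i) WW.
rewrite mxE mulmx_tr_diag [RHS]mxE [X in _ = _ + X]mxE mulmx_tr_diag => e.
have Q1 : c * (W *m Q) i j ^+ 2 <= c * \sum_k (W *m Q) i k ^+ 2.
  by rewrite ler_wpM2l// (bigD1 j)//= lerDl sumr_ge0// => k _; exact: sqr_ge0.
apply: (le_trans Q1); rewrite e.
have W1 : W i i ^+ 2 <= \sum_k W i k ^+ 2.
  by rewrite (bigD1 i)//= lerDl sumr_ge0// => k _; exact: sqr_ge0.
have : W i i - W i i ^+ 2 <= 1 by nra.
lra.
Qed.

(** The difference [Y] of the two sides satisfies [Y Q = 0], while [Y^T] factors through [Q] on the
    left; hence [Y Y^T = 0]. *)
Lemma gram_pinv_cancel {r t} (Q : 'M[R]_(r, t)) (X : 'M[R]_t) :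
  Q^T *m Q *m X *m (Q^T *m Q) = Q^T *m Q ->
  Q^T *m (Q *m X *m Q^T) = Q^T.
Proof.
move=> QX; apply/eqP; rewrite -subr_eq0; apply/eqP/mulmx_tr_eq0.
set Y := _ - Q^T.
have YQ : Y *m Q = 0.
  rewrite /Y mulmxBl -[RHS](subrr (Q^T *m Q)); congr (_ - _).
  by rewrite -[RHS]QX !mulmxA.
have -> : Y^T = Q *m (X^T *m Q^T *m Q - 1%:M).
  by rewrite /Y linearB /= !trmx_mul !trmxK mulmxBr mulmx1 !mulmxA.
by rewrite mulmxA YQ mul0mx.
Qed.

(** [Q Q^T] kills [1 - Z], so [ridge] and its inverse [W] fix it. Therefore [1 - W = Z - W Q X Q^T],
    and the last term tends to 0 with [W Q]. *)
Lemma ridge_cvg {r t} (Q : 'M[R]_(r, t)) (X : 'M[R]_t) i j :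
  Q^T *m Q *m X *m (Q^T *m Q) = Q^T *m Q ->
  (fun n => (1%:M - invmx (ridge Q (n.+1%:R ^+ 2))) i j) @ \oo -->
    ((Q *m X *m Q^T) i j : R).
Proof.
move=> QX; set Z := Q *m X *m Q^T; pose Y := X *m Q^T.
have GZ : Q *m Q^T *m Z = Q *m Q^T by rewrite -mulmxA /Z gram_pinv_cancel.
pose k := \sum_b `|Y b j|.
have ZE n : (1%:M - invmx (ridge Q (n.+1%:R ^+ 2))) i j =
    Z i j - \sum_b (invmx (ridge Q (n.+1%:R ^+ 2)) *m Q) i b * Y b j.
  set c := n.+1%:R ^+ 2; set W := invmx _.
  have Wu : ridge Q c \in unitmx by apply: ridge_unit; exact: sqr_ge0.
  have e : ridge Q c *m (1%:M - Z) = 1%:M - Z.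
    by rewrite {1}/ridge mulmxDl mul1mx -scalemxAl mulmxBr mulmx1 GZ subrr
      scaler0 addr0.
  have -> : 1%:M - W = Z - W *m Q *m Y.
    have := congr1 (mulmx W) e; rewrite mulKmx// mulmxBr mulmx1 => h.
    have -> : W *m Q *m Y = W *m Z by rewrite /Y /Z !mulmxA.
    have {1}-> : 1%:M = W - W *m Z + Z by rewrite -h subrK.
    by rewrite addrAC [W - _]addrC addrK addrC.
  by rewrite mxE [X in _ + X]mxE [X in _ - X]mxE.
under eq_fun do rewrite ZE.
(* Taking [c] to be a square makes the bound on [W Q] the harmonic sequence. *)
have bnd n : `|\sum_b (invmx (ridge Q (n.+1%:R ^+ 2)) *m Q) i b * Y b j| <=
    k * harmonic n.
  rewrite mulr_suml (le_trans (ler_norm_sum _ _ _))//; apply: ler_sum => b _.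
  have n0 : 0 < n.+1%:R :> R by rewrite ltr0n.
  have -> : harmonic n = 1 / n.+1%:R :> R by rewrite /harmonic /= div1r.
  rewrite normrM mulrC ler_wpM2l//. rewrite ler_pdivlMr//.
  have := ridge_mul_le Q (n.+1%:R ^+ 2) i b (sqr_ge0 _).
  rewrite -exprMn -[_ ^+ 2]real_normK ?num_real// expr_le1//.
  by rewrite normrM (ger0_norm (ltW n0)) [_ * n.+1%:R]mulrC.
apply: (@squeeze_cvgr _ _ _ _ (fun n => Z i j - k * harmonic n) (fun n =>
  Z i j + k * harmonic n)).
- apply: nearW => n; have := bnd n; rewrite ler_norml => /andP[]; lra.
- rewrite -[X in _ --> X]subr0 -[X in _ - X](mulr0 k).
  by apply: cvgB; [exact: cvg_cst|apply: cvgMr; exact: cvg_harmonic].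
- rewrite -[X in _ --> X]addr0 -[X in _ + X](mulr0 k).
  by apply: cvgD; [exact: cvg_cst|apply: cvgMr; exact: cvg_harmonic].
Qed.

End GramLimit.

(** * Measurability of matrix operations, entry by entry *)

Section MeasurableMatrices.
Context {R : realType} {d : measure_display} {T : measurableType d}.

Definition mx_measurable {m n} (F : T -> 'M[R]_(m, n)) :=
  forall i j, measurable_fun setT (fun w => F w i j).

Lemma mx_measurable_cst {m n} (A : 'M[R]_(m, n)) : mx_measurable (fun=> A).
Proof. by move=> i j; exact: measurable_cst. Qed.

Lemma mx_measurableD {m n} (F G : T -> 'M[R]_(m, n)) :
  mx_measurable F -> mx_measurable G -> mx_measurable (fun w => F w + G w).
Proof.
move=> mF mG i j.
rewrite [X in measurable_fun _ X](_ : _ = (fun w => F w i j) \+ (fun w =>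
  G w i j)).
  exact: measurable_funD.
by apply/funext => w; rewrite mxE.
Qed.

Lemma mx_measurableZ {m n} (f : T -> R) (F : T -> 'M[R]_(m, n)) :
  measurable_fun setT f -> mx_measurable F -> mx_measurable (fun w => f w *: F w).
Proof.
move=> mf mF i j.
rewrite [X in measurable_fun _ X](_ : _ = f \* (fun w => F w i j)).
  exact: measurable_funM.
by apply/funext => w; rewrite mxE.
Qed.

Lemma mx_measurableM {m n p} (F : T -> 'M[R]_(m, n)) (G : T -> 'M[R]_(n, p)) :
  mx_measurable F -> mx_measurable G -> mx_measurable (fun w => F w *m G w).
Proof.
move=> mF mG i j.
rewrite [X in measurable_fun _ X](_ : _ =
    fun w => \sum_k ((fun w => F w i k) \* (fun w => G w k j)) w).
  by apply: measurable_sum => k; exact: measurable_funM.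
by apply/funext => w; rewrite mxE.
Qed.

Lemma mx_measurable_tr {m n} (F : T -> 'M[R]_(m, n)) :
  mx_measurable F -> mx_measurable (fun w => (F w)^T).
Proof.
move=> mF i j; rewrite [X in measurable_fun _ X](_ : _ = fun w => F w j i)//.
by apply/funext => w; rewrite mxE.
Qed.

Lemma measurable_det {n} (F : T -> 'M[R]_n) :
  mx_measurable F -> measurable_fun setT (fun w => \det (F w)).
Proof.
move=> mF; rewrite /determinant; apply: measurable_sum => s.
apply: measurable_funM; first exact: measurable_cst.
by apply: measurable_prod => i _; exact: mF.
Qed.

Lemma measurable_invr (f : T -> R) : (forall w, f w != 0) ->
  measurable_fun setT f -> measurable_fun setT (fun w => (f w)^-1).
Proof.
move=> f0 mf; pose D : set R := [set x | x != 0].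
have oD : open D by exact: open_neq.
have : measurable_fun D (@GRing.inv R).
  apply: open_continuous_measurable_fun => // x; rewrite inE => x0.
  exact: inv_continuous.
move=> mi; apply: (@measurable_comp _ _ _ _ _ _ D) => //.
- exact: open_measurable.
- by move=> _ [w _ <-]; exact: f0.
Qed.

(** Cramer's formula: the entries are signed minors over a determinant that never vanishes. *)
Lemma mx_measurable_inv {n} (F : T -> 'M[R]_n) :
  (forall w, F w \in unitmx) -> mx_measurable F ->
  mx_measurable (fun w => invmx (F w)).
Proof.
move=> Fu mF.
have -> : (fun w => invmx (F w)) = (fun w => (\det (F w))^-1 *: \adj (F w)).
  by apply/funext => w; rewrite /invmx Fu.
apply: mx_measurableZ.
  apply: measurable_invr => [w|]; last exact: measurable_det.
  by have := Fu w; rewrite unitmxE unitfE.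
move=> i j; rewrite [X in measurable_fun _ X](_ : _ = fun w =>
  (-1) ^+ (j + i) * \det (row' j (col' i (F w)))).
  apply: measurable_funM; first exact: measurable_cst.
  apply: measurable_det => a b.
  rewrite [X in measurable_fun _ X](_ : _ = fun w => F w (lift j a) (lift i b))//.
  by apply/funext => w; rewrite !mxE.
by apply/funext => w; rewrite mxE.
Qed.

End MeasurableMatrices.

Section SketchMeasurability.
Context {R : realType} {l m r tau : nat}.
Local Notation tubalR := (tubal R l).
Variables (A : tubalR m r) (M : tubalR r r).
Hypothesis Mp : T_posdef M.

Lemma tubal_coord_measurable {p q} k i j :
  measurable_fun setT (fun X : mtubal R l p q => X k i j).
Proof.
move=> _ B mB; rewrite setTI; apply: sub_sigma_algebra.
by exists k, i, j, B.
Qed.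

Lemma bcirc_measurable {p q} :
  mx_measurable (fun X : mtubal R l p q => bcirc (X : tubalR p q)).
Proof.
move=> a b; rewrite (_ : (fun _ => _) = fun X : mtubal R l p q =>
  X (tagnat.sig1 a - tagnat.sig1 b) (tagnat.sig2 a) (tagnat.sig2 b)).
  exact: tubal_coord_measurable.
by apply/funext => X; rewrite mxE.
Qed.

Lemma bcirc_coord {p q} (X : tubalR p q) k i j :
  X k i j = (submxblock (bcirc X) k 0) i j.
Proof. by rewrite /bcirc mxblockK subr0. Qed.

Lemma bcirc_Zproj (S : tubalR m tau) : let Q := bcirc (sketch_factor A M S) in
  exists X, Q^T *m Q *m X *m (Q^T *m Q) = Q^T *m Q /\
    bcirc (Zproj A M S) = Q *m X *m Q^T.
Proof.
exists (bcirc (tpinv (ttr (sketch_factor A M S) ** sketch_factor A M S))).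
rewrite -bcirc_ttr -!bcircM; split; last by rewrite ZprojE.
by have [-> _] := tpinvP (gram_sym (sketch_factor A M S)).
Qed.

Lemma Zproj_measurable k i j :
  measurable_fun setT (fun S : mtubal R l m tau => Zproj A M S k i j).
Proof.
pose F (S : mtubal R l m tau) := bcirc (sketch_factor A M S).
have mF : mx_measurable F.
  rewrite /F /sketch_factor (_ : (fun _ => _) =
      fun S : mtubal R l m tau => bcirc (tinv (tsqrt M) ** ttr A) *m bcirc (S :
        tubalR m tau)).
    apply: mx_measurableM; first exact: mx_measurable_cst.
    exact: bcirc_measurable.
  by apply/funext => S; rewrite bcircM.
(* Block [(k, 0)] of a block circulant matrix is its slice [k]. *)
pose h n S := (1%:M - invmx (ridge (F S) (n.+1%:R ^+ 2)))
  (tagnat.Rank k i) (tagnat.Rank 0 j).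
apply: (@measurable_fun_cvg _ _ _ _ h).
  move=> n; apply: mx_measurableD; first exact: mx_measurable_cst.
  rewrite (_ : (fun _ => _) = fun S => -1 *: invmx (ridge (F S) (n.+1%:R ^+ 2))).
    apply: mx_measurableZ; first exact: measurable_cst.
    apply: mx_measurable_inv => [S|].
      by apply: ridge_unit; exact: sqr_ge0.
    apply: mx_measurableD; first exact: mx_measurable_cst.
    apply: mx_measurableZ; first exact: measurable_cst.
    by apply: mx_measurableM => //; exact: mx_measurable_tr.
  by apply/funext => S; rewrite scaleN1r.
move=> S _; have [X [XE ZE]] := bcirc_Zproj S.
rewrite bcirc_coord ZE mxE; exact: ridge_cvg.
Qed.

(** As [P = P P^T], the entry [P i i] is the sum of the squares in row [i]. It dominates its own
    square, so it is at most 1, and it dominates the other squares of the row. *)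
Lemma mulmx_proj_le1 {n} (P : 'M[R]_n) i j : P^T = P -> P *m P = P ->
  `|P i j| <= 1.
Proof.
move=> Ps PP; have := mulmx_tr_diag P i; rewrite Ps PP => e.
have sq k : P i k ^+ 2 <= P i i.
  by rewrite [leRHS]e (bigD1 k)//= lerDl sumr_ge0// => b _; exact: sqr_ge0.
have Pi : P i i <= 1 by have := sq i; nra.
have : `|P i j| ^+ 2 <= 1 by rewrite real_normK ?num_real// (le_trans (sq j)).
by rewrite expr_le1.
Qed.

Lemma Zproj_le1 (S : tubalR m tau) k i j : `|Zproj A M S k i j| <= 1.
Proof.
rewrite bcirc_coord mxE mulmx_proj_le1//.
  by rewrite -bcirc_ttr Zproj_sym.
by rewrite -bcircM Zproj_idem.
Qed.

End SketchMeasurability.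

(** * Bounded random variables and independence *)

Section BoundedExpectation.
Context {R : realType} {d : measure_display} {T : measurableType d}
  (P : probability T R).

(** Unlike integrability, this property is stable under products, which the expansion of the squared
    error requires. *)
Definition bmeas (f : T -> R) :=
  measurable_fun setT f /\ exists K, forall w, `|f w| <= K.

Definition Ex (f : T -> R) : R := (\int[P]_w f w)%R.

Lemma bmeas_integrable {f : T -> R} : bmeas f -> P.-integrable setT (EFin \o f).
Proof.
move=> [mf [K fK]]; apply: measurable_bounded_integrable => //.
  by apply: (le_lt_trans (probability_le1 P measurableT)); exact: ltry.
exists K; split; first exact: num_real.
by move=> M KM w _; apply: (le_trans (fK w)); exact: ltW.
Qed.

Lemma bmeas_cst (c : R) : bmeas (fun=> c).
Proof. by split; [exact: measurable_cst|exists `|c|]. Qed.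

Lemma bmeasD {f g : T -> R} : bmeas f -> bmeas g -> bmeas (fun w => f w + g w).
Proof.
move=> [mf [K fK]] [mg [L gL]]; split; first exact: measurable_funD.
by exists (K + L) => w; rewrite (le_trans (ler_normD _ _))// lerD.
Qed.

Lemma bmeasM {f g : T -> R} : bmeas f -> bmeas g -> bmeas (fun w => f w * g w).
Proof.
move=> [mf [K fK]] [mg [L gL]]; split; first exact: measurable_funM.
by exists (K * L) => w; rewrite normrM ler_pM.
Qed.

Lemma bmeasZ (c : R) {f : T -> R} : bmeas f -> bmeas (fun w => c * f w).
Proof. exact/bmeasM/bmeas_cst. Qed.

Lemma bmeas_indic {A : set T} : measurable A -> bmeas (\1_A).
Proof.
move=> mA; split; first exact: measurable_indic.
by exists 1 => w; rewrite indicE; case: (_ \in _); rewrite /= ?normr1 ?normr0.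
Qed.

Lemma bmeas_sum {I : Type} (s : seq I) (f : I -> T -> R) :
  (forall i, bmeas (f i)) -> bmeas (fun w => \sum_(i <- s) f i w).
Proof.
move=> bf; elim: s => [|i s IHs].
  by under eq_fun do rewrite big_nil; exact: bmeas_cst.
by under eq_fun do rewrite big_cons; exact: bmeasD.
Qed.

Lemma eq_Ex {f g : T -> R} : f =1 g -> Ex f = Ex g.
Proof. by move=> fg; congr Ex; apply/funext. Qed.

Lemma ExD (f g : T -> R) : bmeas f -> bmeas g ->
  Ex (fun w => f w + g w) = Ex f + Ex g.
Proof. by move=> bf bg; rewrite /Ex RintegralD//; exact: bmeas_integrable. Qed.

Lemma ExZ (c : R) (f : T -> R) : bmeas f -> Ex (fun w => c * f w) = c * Ex f.
Proof. by move=> bf; rewrite /Ex RintegralZl//; exact: bmeas_integrable. Qed.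

Lemma Ex_cst (c : R) : Ex (fun=> c) = c.
Proof. by rewrite /Ex Rintegral_cst// -[X
  in fine X]/(P setT) probability_setT mulr1. Qed.

Lemma Ex_sum {I : Type} (s : seq I) (f : I -> T -> R) : (forall i, bmeas (f i)) ->
  Ex (fun w => \sum_(i <- s) f i w) = \sum_(i <- s) Ex (f i).
Proof.
move=> bf; elim: s => [|i s IHs].
  rewrite big_nil -[RHS](Ex_cst 0); apply: eq_Ex => w; exact: big_nil.
rewrite big_cons -IHs -ExD//; last exact: bmeas_sum.
by apply: eq_Ex => w; rewrite big_cons.
Qed.

Lemma le_Ex (f g : T -> R) : bmeas f -> bmeas g -> (forall w, f w <= g w) ->
  Ex f <= Ex g.
Proof. by move=> bf bg fg; apply: le_Rintegral => //;
  exact: bmeas_integrable. Qed.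

Lemma Ex_norm_le (f : T -> R) (K : R) : bmeas f -> (forall w, `|f w| <= K) ->
  `|Ex f| <= K.
Proof.
move=> bf fK; rewrite ler_norml; apply/andP; split.
  rewrite -[leLHS]Ex_cst; apply: le_Ex => //; first exact: bmeas_cst.
  by move=> w; have := fK w; rewrite ler_norml => /andP[].
rewrite -[leRHS]Ex_cst; apply: le_Ex => //; first exact: bmeas_cst.
by move=> w; have := fK w; rewrite ler_norml => /andP[].
Qed.

Lemma Ex_sub_le (c : R) (f g h : T -> R) : bmeas f -> bmeas g -> bmeas h ->
  Ex g = Ex h -> (forall w, f w - h w <= c * f w) ->
  Ex (fun w => f w + -1 * g w) <= c * Ex f.
Proof.
move=> bf bg bh gh fhc; rewrite ExD ?ExZ ?gh//; last exact: bmeasZ.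
have -> : -1 * Ex h = Ex (fun w => -1 * h w) by rewrite ExZ.
rewrite -ExD//; last exact: bmeasZ.
rewrite -ExZ//; apply: le_Ex; [|exact: bmeasZ|].
  by apply: bmeasD => //; exact: bmeasZ.
by move=> w; rewrite mulN1r.
Qed.

Lemma Ex_indic (A : set T) : measurable A -> Ex (\1_A) = fine (P A).
Proof. by move=> mA; rewrite /Ex /Rintegral integral_indic// setIT. Qed.

(** Taking [B = setT] forces [c] to be the mean of [g]; the condition says that [g] is uncorrelated
    with every event determined by [z]. *)
Definition decorrelated (g : T -> R) (c : R) (z : T -> R) :=
  forall B : set R, measurable B ->
    Ex (fun w => g w * \1_(z @^-1` B) w) = c * Ex (\1_(z @^-1` B)).

(* Halving: with [A = {z >= 1/2}], [z = (1_A + z') / 2] where [z' = 2 z - 1_A]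
   again takes values in [0, 1], so the discrepancy is halved at each step. *)
Lemma decorrelated_unit (g : T -> R) (c K : R) n (z : T -> R) : bmeas g ->
  (forall w, `|g w| <= K) ->
  measurable_fun setT z -> (forall w, 0 <= z w <= 1) -> decorrelated g c z ->
  `|Ex (fun w => g w * z w) - c * Ex z| <= (K + `|c|) / 2 ^+ n.
Proof.
move=> bg gK; elim: n z => [|n IHn] z mz z01 gcz.
  have bz : bmeas z.
    by split=> //; exists 1 => w; have /andP[z0 z1] := z01 w; rewrite ger0_norm.
  rewrite expr0 divr1 (le_trans (ler_normB _ _))// lerD//.
    apply: Ex_norm_le; first exact: bmeasM.
    move=> w; rewrite normrM -[leRHS]mulr1 ler_pM//.
    by have /andP[z0 z1] := z01 w; rewrite ger0_norm.
  rewrite normrM -[leRHS]mulr1 ler_wpM2l// Ex_norm_le// => w.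
  by have /andP[z0 z1] := z01 w; rewrite ger0_norm.
pose h (x : R) : R := 2 * x - \1_(`[2^-1, +oo[%classic) x.
have mh : measurable_fun setT h.
  apply: measurable_funB; last exact: measurable_indic.
  by apply: measurable_funM => //; exact: measurable_id.
pose A := z @^-1` `[2^-1, +oo[%classic.
have mA : measurable A by rewrite -[A]setTI; exact: mz.
have hE (x : R) : \1_(`[2^-1, +oo[%classic) x = (2^-1 <= x)%R%:R :> R.
  by rewrite indicE; congr ((nat_of_bool _)%:R); apply/idP/idP;
    rewrite inE/= in_itv/= andbT.
have AE w : \1_A w = (2^-1 <= z w)%R%:R :> R by rewrite -hE.
pose z' := h \o z.
have z'E w : z' w = 2 * z w - \1_A w by rewrite /z' /h /= hE AE.
have mz' : measurable_fun setT z' by exact: measurableT_comp.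
have z'01 w : 0 <= z' w <= 1.
  have := z01 w; rewrite z'E AE; case: (lerP 2^-1 (z w)) => /= zw; lra.
have bz' : bmeas z'.
  by split=> //; exists 1 => w; have /andP[z0 z1] := z'01 w; rewrite ger0_norm.
have gcz' : decorrelated g c z'.
  move=> B mB; rewrite (_ : z' @^-1` B = z @^-1` (h @^-1` B))//; apply: gcz.
  by rewrite -[_ @^-1` _]setTI; exact: mh.
have bA := bmeas_indic mA.
have -> : Ex z = (2^-1 : R) * (Ex \1_A + Ex z').
  rewrite -ExD//; apply: etrans (ExZ _ _ (bmeasD bA bz')).
  by apply: eq_Ex => w; rewrite z'E; field.
have [bgA bgz'] := (bmeasM bg bA, bmeasM bg bz').
have -> : Ex (fun w => g w * z w) =
    (2^-1 : R) * (Ex (fun w => g w * \1_A w) + Ex (fun w => g w * z' w)).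
  rewrite -ExD//; apply: etrans (ExZ _ _ (bmeasD bgA bgz')).
  by apply: eq_Ex => w; rewrite z'E; field.
rewrite gcz -/A; last exact: measurable_itv.
have := IHn z' mz' z'01 gcz'.
move: (Ex _) (Ex \1_A) (Ex z') => a b e ae.
have -> : 2^-1 * (c * b + a) - c * (2^-1 * (b + e)) = 2^-1 * (a - c * e) by ring.
rewrite normrM ger0_norm ?invr_ge0// exprS invfM [leRHS]mulrCA.
by rewrite ler_pM2l ?invr_gt0.
Qed.

(** An affine change of variable brings [z] into [[0, 1]], where the discrepancy is below a constant
    over [2 ^+ n] for all [n], hence zero. *)
Lemma decorrelated_Ex (g : T -> R) (c : R) (z : T -> R) :
  bmeas g -> bmeas z -> decorrelated g c z ->
  Ex (fun w => g w * z w) = c * Ex z.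
Proof.
move=> bg bz gcz; have [mz [L0 zL0]] := bz; have [_ [K gK]] := bg.
(* The added 1 makes the scale [2 * L] invertible even if [L0 = 0]. *)
pose L := `|L0| + 1.
have L0' : 0 < L by rewrite ltr_wpDl.
have zL w : `|z w| <= L.
  by rewrite (le_trans (zL0 w))// (le_trans (ler_norm _))// lerDl.
pose h (x : R) : R := (x + L) / (2 * L).
have mh : measurable_fun setT h.
  apply: measurable_funM => //; apply: measurable_funD => //;
    exact: measurable_id.
pose z' := h \o z.
have mz' : measurable_fun setT z' by exact: measurableT_comp.
have z'01 w : 0 <= z' w <= 1.
  have := zL w; rewrite ler_norml => /andP[z1 z2]; rewrite /z' /h /=.
  by rewrite divr_ge0 ?ler_pdivrMr ?mulr_gt0//; lra.
have bz' : bmeas z'.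
  by split=> //; exists 1 => w; have /andP[z0 z1] := z'01 w; rewrite ger0_norm.
have gcz' : decorrelated g c z'.
  move=> B mB; rewrite (_ : z' @^-1` B = z @^-1` (h @^-1` B))//; apply: gcz.
  by rewrite -[_ @^-1` _]setTI; exact: mh.
have e : Ex (fun w => g w * z' w) = c * Ex z'.
  apply/eqP; rewrite -subr_eq0 -normr_eq0; set a := `|_|; apply/negPn/negP => a0.
  have {}a0 : 0 < a by rewrite lt_neqAle eq_sym a0 normr_ge0.
  pose n := Num.bound (`|K + `|c| | / a).
  have := archi_boundP (divr_ge0 (normr_ge0 (K + `|c|)) (ltW a0)); rewrite -/n.
  rewrite ltr_pdivrMr// => nK.
  have := decorrelated_unit _ _ _ n _ bg gK mz' z'01 gcz'; rewrite -/a.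
  rewrite ler_pdivlMr ?exprn_gt0// leNgt => /negP; apply.
  rewrite (le_lt_trans (ler_norm _))// (lt_le_trans nK)// mulrC ler_wpM2l ?ltW//.
  by rewrite -natrX ltr_nat ltn_expl.
have zE w : z w = 2 * L * z' w + - L.
  by rewrite /z' /h /=; field; rewrite gt_eqF.
have g1 : Ex g = c.
  have := gcz setT measurableT; rewrite preimage_setT indicT Ex_cst mulr1 => <-.
  by apply: eq_Ex => w; rewrite mulr1.
have -> : Ex z = 2 * L * Ex z' + - L.
  rewrite -[X in _ + X]Ex_cst -ExZ// -ExD//; last exact: bmeas_cst.
    exact: eq_Ex.
  by apply: bmeasM => //; exact: bmeas_cst.
rewrite mulrDr mulrCA -e mulrN -g1 [Ex g * L]mulrC -mulNr -!ExZ//;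
  last exact: bmeasM.
rewrite -ExD; last by apply: bmeasM => //; exact: bmeas_cst.
  by apply: eq_Ex => w; rewrite zE; ring.
by apply: bmeasM; [exact: bmeas_cst|exact: bmeasM].
Qed.

End BoundedExpectation.

(** * Factorization of means over independent sources *)

Section IndependentFactors.
Context {R : realType} {d : measure_display} {T : measurableType d}
  {P : probability T R} {I : eqType} {F : I -> set (set T)}.
Hypotheses (mF : forall i E, F i E -> measurable E)
  (indF : mutually_independent P F).

Local Notation Ex := (Ex P).

Definition bmeas_in (i : I) (z : T -> R) :=
  bmeas z /\ forall B : set R, measurable B -> F i (z @^-1` B).

Definition inter (J : seq I) (E : I -> set T) : set T :=
  \bigcap_(i in [set` J]) E i.

(* Only the mean of [f] is required to factor, not its law: this makes the class
   linear and stable under multiplication by factors from new sources, which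
   suffices for the error recursion. *)
Definition indep_past (Q : seq I) (f : T -> R) :=
  bmeas f /\ forall (J : seq I) (E : I -> set T), uniq J ->
    (forall i, i \in J -> i \notin Q) -> (forall i, i \in J -> F i (E i)) ->
    Ex (fun w => f w * \1_(inter J E) w) = Ex f * \prod_(i <- J) fine (P (E i)).

Lemma inter_cons i J (E : I -> set T) (A : set T) : i \notin J ->
  inter (i :: J) (fun j => if j == i then A else E j) = A `&` inter J E.
Proof.
move=> iJ; apply/seteqP; split => w /=.
  move=> H; split; first by have := H i; rewrite /= mem_head eqxx; exact.
  move=> j /= jJ; have := H j; rewrite /= inE jJ orbT.
  by have [ji|_] := eqVneq j i; [rewrite -ji jJ in iJ|exact].
move=> [Aw H] j /=; rewrite inE; case: eqVneq => [//|ji] /=; exact: H.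
Qed.

Lemma inter_nil (E : I -> set T) : inter [::] E = setT.
Proof. by apply/seteqP; split => w //= _ j. Qed.

Lemma inter_measurable J (E : I -> set T) :
  (forall i, i \in J -> F i (E i)) -> measurable (inter J E).
Proof.
elim: J => [_|i J IHJ JE]; first by rewrite inter_nil.
rewrite (_ : inter _ _ = E i `&` inter J E).
  apply: measurableI; first by apply/mF/JE; rewrite mem_head.
  by apply: IHJ => j jJ; apply: JE; rewrite inE jJ orbT.
apply/seteqP; split => w /=.
  move=> H; split=> [|j jJ]; apply: H; rewrite /= ?mem_head//.
  by rewrite inE orbC; apply/orP; left.
by move=> [Ew H] j /=; rewrite inE => /predU1P[->//|]; exact: H.
Qed.

(** For a constant the condition is mutual independence itself, moved from extended reals to
    reals. *)
Lemma indep_past_cst (c : R) : indep_past [::] (fun=> c).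
Proof.
split=> [|J E uJ _ JE]; first exact: bmeas_cst.
have mJE := inter_measurable J E JE.
rewrite ExZ ?Ex_cst ?Ex_indic//; last exact: bmeas_indic.
congr (_ * _).
have -> : P (inter J E) = \big[*%E/1%E]_(i <- J) P (E i) by exact: indF.
suff -> : \big[*%E/1%E]_(i <- J) P (E i) = (\prod_(i <- J) fine (P
  (E i)))%:E by [].
have : forall i, i \in J -> P (E i) = (fine (P (E i)))%:E.
  by move=> i iJ; rewrite fineK// fin_num_measure//; exact/mF/JE.
elim: J {uJ JE mJE} => [_|i J IHJ PJ]; first by rewrite !big_nil.
rewrite !big_cons EFinM -IHJ => [|j jJ]; last by apply: PJ; rewrite inE jJ orbT.
by rewrite {1}PJ// mem_head.
Qed.

Lemma indep_past_sub Q Q' f : {subset Q <= Q'} ->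
  indep_past Q f -> indep_past Q' f.
Proof.
move=> QQ' [bf fJ]; split=> // J E uJ JQ JE; apply: fJ => // i iJ.
by apply: contra (JQ i iJ); exact: QQ'.
Qed.

Lemma indep_past_sum {K : Type} (s : seq K) Q (f : K -> T -> R) :
  (forall k, indep_past Q (f k)) -> indep_past Q (fun w => \sum_(k <- s) f k w).
Proof.
move=> fQ; have bf k : bmeas (f k) := (fQ k).1.
split=> [|J E uJ JQ JE]; first exact: bmeas_sum.
have bJ : bmeas (\1_(inter J E) : T -> R) by apply: bmeas_indic;
  exact: inter_measurable.
rewrite Ex_sum// mulr_suml.
transitivity (\sum_(k <- s) Ex (fun w => f k w * \1_(inter J E) w)); last first.
  by apply: eq_bigr => k _; rewrite (fQ k).2.
rewrite -Ex_sum => [|k]; last exact: bmeasM.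
by apply: eq_Ex => w; rewrite mulr_suml.
Qed.

(** For a family [J] avoiding [i :: Q], the hypothesis on [f] with an event of [z] adjoined to [J]
    says that [f] times the indicator of [J] is decorrelated from [z]. The empty family gives the
    formula for the mean. *)
Lemma indep_pastM Q f i z : indep_past Q f -> i \notin Q -> bmeas_in i z ->
  indep_past (i :: Q) (fun w => f w * z w) /\
  Ex (fun w => f w * z w) = Ex f * Ex z.
Proof.
move=> [bf fJ] iQ [bz zF].
have key J E : uniq J -> (forall j, j \in J -> j \notin i :: Q) ->
    (forall j, j \in J -> F j (E j)) ->
    Ex (fun w => f w * z w * \1_(inter J E) w) =
      Ex f * \prod_(i <- J) fine (P (E i)) * Ex z.
  move=> uJ JQ JE.
  have bJ : bmeas (\1_(inter J E) : T -> R) by apply: bmeas_indic;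
    exact: inter_measurable.
  rewrite -(decorrelated_Ex P (fun w => f w * \1_(inter J E) w))//.
  - by apply: eq_Ex => w; rewrite mulrAC.
  - exact: bmeasM.
  move=> B mB; have FA := zF B mB; set A := z @^-1` B in FA *.
  have iJ : i \notin J by apply/negP => /JQ; rewrite mem_head.
  (* The event of [z] enters as the event of the new source [i]. *)
  have := fJ (i :: J) (fun j => if j == i then A else E j).
  rewrite inter_cons// /= iJ uJ big_cons eqxx indicI => fA.
  rewrite -[LHS](_ : Ex (fun w => f w * (\1_A \* \1_(inter J E)) w) = _);
    last first.
    by apply: eq_Ex => w /=; rewrite mulrA mulrAC.
  rewrite fA //.
  - rewrite Ex_indic; last exact: mF FA.
    rewrite -mulrA [X in _ = Ex f * X]mulrC; congr (_ * (_ * _)).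
    rewrite [LHS]big_seq [RHS]big_seq; apply: eq_bigr => j jJ.
    by case: eqVneq => // ji; rewrite -ji jJ in iJ.
  - by move=> j; rewrite inE => /predU1P[->//|/JQ];
    rewrite inE negb_or => /andP[].
  - move=> j; rewrite inE; case: eqVneq => [-> _|_ /=]; [exact: FA|exact: JE].
have e : Ex (fun w => f w * z w) = Ex f * Ex z.
  have := key [::] (fun=> setT) isT; rewrite big_nil mulr1 inter_nil indicT =>
    <- //.
  by apply: eq_Ex => w; rewrite mulr1.
split=> //; split=> [|J E uJ JQ JE]; first exact: bmeasM.
by rewrite key// e mulrAC.
Qed.

End IndependentFactors.

(** * Expected contraction of the error *)

Section TubalEntries.
Context {R : realType} {l : nat}.
Local Notation tubalR := (tubal R l).

Definition ent {m n} (A : tubalR m n) (a : 'I_l.+1 * 'I_m * 'I_n) : R :=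
  A a.1.1 a.1.2 a.2.

Lemma entB {m n} (A B : tubalR m n) a : ent (tsub A B) a = ent A a - ent B a.
Proof. by rewrite /ent /tsub !mxE. Qed.

Lemma tinner_ent {m n} (A B : tubalR m n) : tinner A B = \sum_a ent A a * ent B a.
Proof.
rewrite /tinner pair_bigA /=.
by rewrite (pair_bigA _ (fun (c : 'I_l.+1 * 'I_m) j =>
  A c.1 c.2 j * B c.1 c.2 j)).
Qed.

(** The index [c] joins the position of an entry of [E] with a slice number of [W], which fixes the
    slice of [Z]. This form separates [E], which belongs to the past, from the fresh factors. *)
Lemma tprod3_ent {r s} (Z : tubalR r r) (E : tubalR r s) (W : tubalR s s) a :
  ent (Z ** E ** W) a = \sum_(c : 'I_l.+1 * 'I_r * 'I_s * 'I_l.+1)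
    ent E c.1 * (Z (a.1.1 - c.2 - c.1.1.1) a.1.2 c.1.1.2 * W c.2 c.1.2 a.2).
Proof.
case: a => -[p i] j; rewrite /ent /=.
rewrite -(pair_bigA _ (fun (b : 'I_l.+1 * 'I_r * 'I_s) q =>
  E b.1.1 b.1.2 b.2 * (Z (p - q - b.1.1) i b.1.2 * W q b.2 j))) /=.
rewrite exchange_big tprodE summxE; apply: eq_bigr => q _ /=.
rewrite -(pair_bigA _ (fun (b : 'I_l.+1 * 'I_r) y =>
  E b.1 b.2 y * (Z (p - q - b.1) i b.2 * W q y j))) /=.
rewrite exchange_big mxE; apply: eq_bigr => y _ /=.
rewrite -(pair_bigA _ (fun u x => E u x y * (Z (p - q - u) i x * W q y j))) /=.
rewrite tprodE summxE mulr_suml; apply: eq_bigr => u _.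
by rewrite mxE mulr_suml; apply: eq_bigr => x _; rewrite mulrCA !mulrA.
Qed.

End TubalEntries.

Section TubalExpectation.
Context {R : realType} {l : nat} {d : measure_display} {T : measurableType d}
  (P : probability T R).
Local Notation tubalR := (tubal R l).
Local Notation C := R[i].
Local Notation Ex := (Ex P).

Definition Etub {m n} (Z : T -> tubalR m n) : tubalR m n :=
  fun k => \matrix_(i, j) Ex (fun w => Z w k i j).

Definition bmeas_tub {m n} (Z : T -> tubalR m n) :=
  forall k i j, bmeas (fun w => Z w k i j).

(** Links the complex expectations inside [tesp_rho] to averages of real entries: a Fourier slice is
    a finite combination of these with constant coefficients. *)
Lemma Emx_dft {m n} (Z : T -> tubalR m n) k : bmeas_tub Z ->
  Emx P (fun w => dft (Z w) k) = dft (Etub Z) k.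
Proof.
move=> bZ; apply/matrixP => i j; rewrite mxE.
have RE (I : finType) (f : I -> C) : complex.Re
  (\sum_p f p) = \sum_p complex.Re (f p).
  by apply: (big_morph (@complex.Re R)) => // -[? ?] [? ?].
have IE (I : finType) (f : I -> C) : complex.Im
  (\sum_p f p) = \sum_p complex.Im (f p).
  by apply: (big_morph (@complex.Im R)) => // -[? ?] [? ?].
have dE (A : tubalR m n) : dft A k i j = \sum_p (efun k p)^* * (A p i j)%:C%C.
  by rewrite dftE summxE; apply: eq_bigr => p _; rewrite !mxE.
have ReM (z : C) (x : R) : complex.Re (z * x%:C%C) = complex.Re z * x.
  by case: z => a b /=; rewrite mulr0 subr0.
have ImM (z : C) (x : R) : complex.Im (z * x%:C%C) = complex.Im z * x.
  by case: z => a b /=; rewrite mulr0 add0r.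
have bc c p : bmeas (fun w => c * Z w p i j).
  exact: bmeasZ.
have part (g : C -> R) : (forall f : 'I_l.+1 ->
  C, g (\sum_p f p) = \sum_p g (f p)) ->
    (forall z x, g (z * x%:C%C) = g z * x) ->
    Ex (fun w => g (dft (Z w) k i j)) = g (dft (Etub Z) k i j).
  move=> gE gM; rewrite dE gE.
  transitivity (Ex (fun w => \sum_p g (efun k p)^* * Z w p i j)).
    by apply: eq_Ex => w; rewrite dE gE; apply: eq_bigr => p _; rewrite gM.
  rewrite Ex_sum//; apply: eq_bigr => p _; rewrite gM mxE; exact: ExZ.
by apply/eqP; rewrite eq_complex /=; apply/andP; split; apply/eqP; apply: part.
Qed.

Lemma Etub_sym {n} (Z : T -> tubalR n n) : (forall w, ttr (Z w) = Z w) ->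
  ttr (Etub Z) = Etub Z.
Proof.
move=> Zs; apply: tubalP => k; apply/matrixP => i j; rewrite /ttr !mxE.
by apply: eq_Ex => w; rewrite -[in RHS]Zs /ttr mxE.
Qed.

(** The form of a projection at [X] is the squared norm of [Z w ** X], and nonnegativity survives
    averaging. *)
Lemma Etub_tsym_psd {n} (Z : T -> tubalR n n) : bmeas_tub Z ->
  (forall w, ttr (Z w) = Z w) -> (forall w, Z w ** Z w = Z w) ->
  tsym_psd (Etub Z).
Proof.
move=> bZ Zs ZZ; split=> [|X]; first by rewrite Etub_sym.
pose x := tunfold X.
have qE (B : tubalR n n) : tinner X (B ** X) =
    \sum_j \sum_i (x i 0 * x j 0) * bcirc B i j.
  rewrite tinner_tprod -/x mxE; apply: eq_bigr => j _.
  by rewrite mxE mulr_suml; apply: eq_bigr => i _; rewrite mxE mulrAC.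
have qZ : (fun w => tinner X (Z w ** X)) =
    fun w => \sum_j \sum_i (x i 0 * x j 0) * bcirc (Z w) i j.
  by apply/funext => w; rewrite qE.
have bB i j : bmeas (fun w => bcirc (Z w) i j).
  rewrite (_ : (fun _ => _) = fun w => Z w (tagnat.sig1 i - tagnat.sig1 j)
    (tagnat.sig2 i) (tagnat.sig2 j)); first exact: bZ.
  by apply/funext => w; rewrite mxE.
have bxB i j : bmeas (fun w => (x i 0 * x j 0) * bcirc (Z w) i j).
  exact: bmeasZ.
have -> : tinner X (Etub Z ** X) = Ex (fun w => tinner X (Z w ** X)).
  rewrite qE qZ.
  rewrite Ex_sum => [|j]; last exact: bmeas_sum.
  apply: eq_bigr => j _; rewrite Ex_sum//; apply: eq_bigr => i _.
  rewrite ExZ//; congr (_ * _); rewrite !mxE.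
  by apply: eq_Ex => w; rewrite mxE.
rewrite -[leLHS](Ex_cst P); apply: le_Ex; first exact: bmeas_cst.
  by rewrite qZ; apply: bmeas_sum => j; exact: bmeas_sum.
move=> w; rewrite -ZZ -tprodA -{1}Zs -tinner_mull; exact: tinner_ge0.
Qed.

End TubalExpectation.

(** * One step of the method in mean *)

Section RandomSketch.
Context {R : realType} {l m n r s tau zeta : nat}.
Local Notation tubalR := (tubal R l).
Context {A : tubalR m r} {B : tubalR s n} {M : tubalR r r} {N : tubalR s s}
  {DS : probability (mtubal R l m tau) R} {DV : probability (mtubal R l n zeta) R}
  {d : measure_display} {Omega : measurableType d} {P : probability Omega R}
  {X0 : {RV P >-> mtubal R l r s}}
  {S : nat -> {RV P >-> mtubal R l m tau}}
  {V : nat -> {RV P >-> mtubal R l n zeta}}.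
Hypotheses (Mp : T_posdef M) (Np : T_posdef N)
  (DSE : forall t E, measurable E -> distribution P (S t) E = DS E)
  (DVE : forall t E, measurable E -> distribution P (V t) E = DV E)
  (indSV : mutually_independent P (source_sigma X0 S V)).

Lemma Ex_distribution d' (T' : measurableType d') (Y : {RV P >-> T'})
    (D : probability T' R) (z : T' -> R) :
  (forall E, measurable E -> distribution P Y E = D E) -> bmeas z ->
  Ex P (fun w => z (Y w)) = Ex D z.
Proof.
move=> YD bz; rewrite /Ex /Rintegral; congr fine.
rewrite -(@eq_measure_integral _ _ _ setT D (distribution P Y)) => [|E mE _];
  last exact: YD.
rewrite integral_distribution//; first by apply/measurable_EFinP; exact: bz.1.
have [mz [K zK]] := bz; apply: bmeas_integrable; split.
  by apply: measurableT_comp.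
by exists K => w; exact: zK.
Qed.

Local Notation F := (source_sigma X0 S V).

Lemma source_measurable i E : F i E -> measurable E.
Proof.
by case: i => [[t|t]|] [B' mB' <-]; rewrite setTI; exact: measurable_funPTI.
Qed.

Lemma bmeas_in_RV i d' (T' : measurableType d') (Y : {RV P >-> T'}) (z : T' ->
  R) :
  F i = g_sigma_algebra_preimage Y -> bmeas z ->
  bmeas_in (F := F) i (fun w => z (Y w)).
Proof.
move=> FY [mz [K zK]]; split.
  by split; [exact: measurableT_comp|exists K => w; exact: zK].
move=> B' mB'; rewrite FY; exists (z @^-1` B'); last by rewrite setTI.
by rewrite -[_ @^-1` _]setTI; exact: mz.
Qed.

(** The sources on which the iterate at time [t] may depend. *)
Fixpoint past t : seq (option (nat + nat)) :=
  if t is t'.+1 then [:: Some (inr t'), Some (inl t') & past t'] else [:: None].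

Lemma mem_past t i : i \in past t -> (i == None) ||
  [exists u : 'I_t, (i == Some (inl (u : nat))) || (i == Some (inr (u : nat)))].
Proof.
elim: t => [|t IHt]; first by rewrite inE => ->.
rewrite !inE => /or3P[/eqP->|/eqP->|/IHt/orP[->//|/existsP[u ui]]].
- by apply/orP; right; apply/existsP; exists ord_max; rewrite eqxx orbT.
- by apply/orP; right; apply/existsP; exists ord_max; rewrite eqxx.
- by apply/orP; right; apply/existsP; exists (widen_ord (leqnSn t) u).
Qed.

Lemma past_inl t : Some (inl t) \notin past t.
Proof.
apply/negP => /mem_past/= /existsP[u]; rewrite orbF => /eqP[tu].
by have := ltn_ord u; rewrite -tu ltnn.
Qed.

Lemma past_inr t : Some (inr t) \notin Some (inl t) :: past t.
Proof.
rewrite inE /=; apply/negP => /mem_past/= /existsP[u] /eqP[tu].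
by have := ltn_ord u; rewrite -tu ltnn.
Qed.

Definition EZ : tubalR r r := Etub DS (fun S0 => Zproj A M S0).
Definition EW : tubalR s s := Etub DV (fun V0 => Wproj B N V0).

Lemma bmeas_Zproj : bmeas_tub (fun S0 : mtubal R l m tau => Zproj A M S0).
Proof.
move=> k i j; split; first exact: Zproj_measurable.
by exists 1 => S0; exact: Zproj_le1.
Qed.

Lemma bmeas_Wproj : bmeas_tub (fun V0 : mtubal R l n zeta => Wproj B N V0).
Proof.
rewrite (_ : (fun _ => _) = fun V0 : mtubal R l n zeta => Zproj (ttr B) N V0).
  move=> k i j; split; first exact: Zproj_measurable.
  by exists 1 => S0; exact: Zproj_le1.
by apply/funext => V0; rewrite WprojE.
Qed.

Local Notation rho := (tesp_rho A B M N DS DV).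

Lemma EZW_contraction (E : tubalR r s) :
  tinner E E - tinner E (EZ ** E ** EW) <= rho * tinner E E.
Proof.
rewrite /tesp_rho mulrBl mul1r lerD2l lerN2; apply: tinner_lambda_min => k.
- apply/tsym_psd_dft/Etub_tsym_psd; first exact: bmeas_Zproj.
  + by move=> w; exact: Zproj_sym.
  + by move=> w; exact: Zproj_idem.
- apply/tsym_psd_dft/Etub_tsym_psd; first exact: bmeas_Wproj.
  + by move=> w; rewrite WprojE; exact: Zproj_sym.
  + by move=> w; rewrite WprojE; exact: Zproj_idem.
- rewrite -(Emx_dft DS _ k bmeas_Zproj) -(Emx_dft DV _ k bmeas_Wproj).
  exact: bigmin_le.
Qed.

Section SketchStep.
Variables (t : nat) (E : Omega -> tubalR r s) (iota : Omega -> R).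
Hypotheses (iota0 : forall w, 0 <= iota w)
  (indE : forall a b, indep_past (P := P) (F := F) (past t)
    (fun w => ent (E w) a * ent (E w) b * iota w)).

Let Z w := Zproj A M (S t w).
Let W w := Wproj B N (V t w).
Let E' w := tsub (E w) (Z w ** E w ** W w).

(** The sketches are absorbed one at a time: the right one is still new once the left one has joined
    the past. Their laws then turn the means under [P] into means under [DS] and [DV]. *)
Lemma sketch_factorization a b (z : mtubal R l m tau -> R)
    (y : mtubal R l n zeta -> R) : bmeas z -> bmeas y ->
  let f w := ent (E w) a * ent (E w) b * iota w in
  let g w := f w * z (S t w) * y (V t w) in
  indep_past (P := P) (F := F) (past t.+1) g /\ Ex P g = Ex P f * Ex DS z * Ex
    DV y.
Proof.
move=> bz b_y f g.
have zS := bmeas_in_RV (Some (inl t)) _ _ (S t) z erefl bz.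
have yV := bmeas_in_RV (Some (inr t)) _ _ (V t) y erefl b_y.
have [fz Efz] := indep_pastM source_measurable _ _ _ _ (indE a b) (past_inl t) zS.
have [fzy Efzy] := indep_pastM source_measurable _ _ _ _ fz (past_inr t) yV.
split=> //; rewrite /g Efzy Efz (Ex_distribution _ _ (S t) DS z (DSE t) bz).
by rewrite (Ex_distribution _ _ (V t) DV y (DVE t) b_y).
Qed.

(** A product of two new entries is a sum of products of two old entries with bounded functions of
    the fresh sketches, so the hypothesis on [E] reproduces itself. *)
Lemma sketch_step_indep a b : indep_past (P := P) (F := F) (past t.+1)
  (fun w => ent (E' w) a * ent (E' w) b * iota w).
Proof.
pose C := ('I_l.+1 * 'I_r * 'I_s * 'I_l.+1)%type.
(* [None] stands for the entry of [E w] itself and [Some c] for a term of the triple product, whose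
   minus sign is put into [ze]. *)
pose os : seq (option C) := None :: [seq Some c | c <- enum {: C}].
pose be (a : 'I_l.+1 * 'I_r * 'I_s) (o :
  option C) := if o is Some c then c.1 else a.
pose ze (a : 'I_l.+1 * 'I_r * 'I_s) (o : option C) (S0 : mtubal R l m tau) : R :=
  if o is Some c then - Zproj A M S0 (a.1.1 - c.2 - c.1.1.1) a.1.2 c.1.1.2 else 1.
pose om (a : 'I_l.+1 * 'I_r * 'I_s) (o : option C) (V0 : mtubal R l n zeta) : R :=
  if o is Some c then Wproj B N V0 c.2 c.1.2 a.2 else 1.
have bze a' o : bmeas (ze a' o).
  case: o => [c|]; last exact: bmeas_cst.
  rewrite (_ : ze _ _ = fun S0 => -1 *
    Zproj A M S0 (a'.1.1 - c.2 - c.1.1.1) a'.1.2 c.1.1.2).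
    exact/bmeasZ/bmeas_Zproj.
  by apply/funext => S0; rewrite mulN1r.
have bom a' o : bmeas (om a' o).
  by case: o => [c|]; [exact: bmeas_Wproj|exact: bmeas_cst].
have entE' w a' : ent (E' w) a' =
    \sum_(o <- os) ent (E w) (be a' o) * (ze a' o (S t w) * om a' o (V t w)).
  rewrite big_cons big_map big_enum /= !mulr1 /E'.
  rewrite entB tprod3_ent -sumrN; congr (_ + _); apply: eq_bigr => c _.
  by rewrite mulNr mulrN.
rewrite (_ : (fun _ => _) = fun w => \sum_(o <- os) \sum_(o' <- os)
    ent (E w) (be a o) * ent (E w) (be b o') * iota w *
    (ze a o (S t w) * ze b o' (S t w)) * (om a o (V t w) * om b o' (V t w))).
  apply: indep_past_sum source_measurable _ _ _ _ _ => o.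
  apply: indep_past_sum source_measurable _ _ _ _ _ => o'.
  by apply: (sketch_factorization _ _ (fun S0 => ze a o S0 * ze b o' S0)
    (fun V0 => om a o V0 * om b o' V0) _ _).1; exact: bmeasM.
apply/funext => w; rewrite !entE' mulr_suml mulr_suml; apply: eq_bigr => o _.
rewrite mulr_sumr mulr_suml; apply: eq_bigr => o' _; ring.
Qed.

(** Once [Z w] and [W w] are replaced by their means under the expectation, the inequality holds for
    each [w] separately, and a nonnegative weight [iota] preserves it. *)
Lemma Ex_sketch_step :
  Ex P (fun w => tinner (E' w) (E' w) * iota w) <=
  rho * Ex P (fun w => tinner (E w) (E w) * iota w).
Proof.
pose C := ('I_l.+1 * 'I_r * 'I_s * 'I_l.+1)%type.
have bf a b : bmeas (fun w => ent (E w) a * ent (E w) b * iota w) := (indE a b).1.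
have tE w (U : tubalR r r) (Y : tubalR s s) :
  tinner (E w) (U ** E w ** Y) * iota w =
    \sum_a \sum_(c : C) ent (E w) a * ent (E w) c.1 * iota w *
      U (a.1.1 - c.2 - c.1.1.1) a.1.2 c.1.1.2 * Y c.2 c.1.2 a.2.
  rewrite tinner_ent mulr_suml; apply: eq_bigr => a _.
  rewrite tprod3_ent mulr_sumr mulr_suml; apply: eq_bigr => c _; ring.
have eqE : Ex P (fun w => tinner (E w) (Z w ** E w ** W w) * iota w) =
    Ex P (fun w => tinner (E w) (EZ ** E w ** EW) * iota w).
  have bS (U : Omega -> tubalR r r) (Y : Omega -> tubalR s s) :
      (forall a c, bmeas (fun w => ent (E w) a * ent (E w) c.1 * iota w *
        U w (a.1.1 - c.2 - c.1.1.1) a.1.2 c.1.1.2 * Y w c.2 c.1.2 a.2)) ->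
      Ex P (fun w => tinner (E w) (U w ** E w ** Y w) * iota w) =
      \sum_a \sum_(c : C) Ex P (fun w => ent (E w) a * ent (E w) c.1 * iota w *
        U w (a.1.1 - c.2 - c.1.1.1) a.1.2 c.1.1.2 * Y w c.2 c.1.2 a.2).
    move=> bUY; rewrite (_ : (fun _ => _) = fun w => \sum_a \sum_(c : C)
      ent (E w) a * ent (E w) c.1 * iota w *
        U w (a.1.1 - c.2 - c.1.1.1) a.1.2 c.1.1.2 * Y w c.2 c.1.2 a.2).
      rewrite Ex_sum => [|a]; last exact: bmeas_sum.
      by apply: eq_bigr => a _; rewrite Ex_sum.
    by apply/funext => w; rewrite tE.
  have fac a (c : C) := sketch_factorization a c.1
    (fun S0 => Zproj A M S0 (a.1.1 - c.2 - c.1.1.1) a.1.2 c.1.1.2)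
    (fun V0 => Wproj B N V0 c.2 c.1.2 a.2) (bmeas_Zproj _ _ _)
      (bmeas_Wproj _ _ _).
  rewrite bS => [|a c]; last exact: (fac a c).1.1.
  rewrite (bS (fun=> EZ) (fun=> EW)) => [|a c]; last first.
    exact/bmeasM/bmeas_cst/bmeasM/bmeas_cst.
  apply: eq_bigr => a _; apply: eq_bigr => c _; rewrite (fac a c).2.
  rewrite -[LHS]mulrA [LHS]mulrC -(ExZ P (_ * _))//.
  apply: eq_Ex => w; rewrite !mxE; ring.
have bEE : bmeas (fun w => tinner (E w) (E w) * iota w).
  rewrite (_ : (fun _ => _) = fun w => \sum_a ent (E w) a * ent (E w) a * iota w).
    exact: bmeas_sum.
  by apply/funext => w; rewrite tinner_ent mulr_suml.
have bEU (U : tubalR r r) (Y : tubalR s s) :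
    bmeas (fun w => tinner (E w) (U ** E w ** Y) * iota w).
  rewrite (_ : (fun _ => _) = fun w => \sum_a \sum_(c : C)
      ent (E w) a * ent (E w) c.1 * iota w *
      U (a.1.1 - c.2 - c.1.1.1) a.1.2 c.1.1.2 * Y c.2 c.1.2 a.2).
    do 2!apply: bmeas_sum => ?.
    exact/bmeasM/bmeas_cst/bmeasM/bmeas_cst.
  by apply/funext => w; rewrite tE.
have bEZW : bmeas (fun w => tinner (E w) (Z w ** E w ** W w) * iota w).
  rewrite (_ : (fun _ => _) = fun w => \sum_a \sum_(c : C)
      ent (E w) a * ent (E w) c.1 * iota w *
      Z w (a.1.1 - c.2 - c.1.1.1) a.1.2 c.1.1.2 * W w c.2 c.1.2 a.2).
    apply: bmeas_sum => a; apply: bmeas_sum => c.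
    exact: (sketch_factorization a c.1
      (fun S0 => Zproj A M S0 (a.1.1 - c.2 - c.1.1.1) a.1.2 c.1.1.2)
      (fun V0 => Wproj B N V0 c.2 c.1.2 a.2) (bmeas_Zproj _ _ _)
        (bmeas_Wproj _ _ _)).1.1.
  by apply/funext => w; rewrite tE.
rewrite (_ : (fun _ => _) = fun w => tinner (E w) (E w) * iota w +
    -1 * (tinner (E w) (Z w ** E w ** W w) * iota w)); last first.
  apply/funext => w.
  have Ws : ttr (W w) = W w by rewrite /W WprojE; exact: Zproj_sym.
  have WW : W w ** W w = W w by rewrite /W WprojE; exact: Zproj_idem.
  have := tinner_proj (Z w) (W w) (E w) (Zproj_sym A M Mp _)
    (Zproj_idem A M Mp _) Ws WW.
  by rewrite -/(E' w) => ->; rewrite mulrBl mulN1r.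
apply: Ex_sub_le bEE bEZW (bEU EZ EW) eqE _ => w.
by rewrite -mulrBl mulrA ler_wpM2r//; exact: EZW_contraction.
Qed.

End SketchStep.

End RandomSketch.

(** The gap [k = g - f] is positive on [D]. The integral of [f] is finite and can be cancelled, so
    [k] has integral 0; this also covers infinite values of [g]. *)
Lemma integral_lt_negligible {d : measure_display} {T : measurableType d}
    {R : realType} (mu : measure T R) (D : set T) (f : T -> R) (g : T -> \bar R) :
  measurable D -> measurable_fun D f -> measurable_fun D g ->
  (forall x, D x -> 0 <= f x) -> (forall x, D x -> ((f x)%:E < g x)%E) ->
  (\int[mu]_(x in D) (f x)%:E < +oo)%E ->
  (\int[mu]_(x in D) g x <= \int[mu]_(x in D) (f x)%:E)%E ->
  mu.-negligible D.
Proof.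
move=> mD mf mg f0 fg foo gf.
pose k x := (g x - (f x)%:E)%E.
have k0 x : D x -> (0 < k x)%E by move=> Dx; rewrite sube_gt0 fg.
have mfE : measurable_fun D (EFin \o f) by exact/measurable_EFinP.
have mk : measurable_fun D k by exact: emeasurable_funB.
have gE : (\int[mu]_(x in D) g x = \int[mu]_(x in D) (f x)%:E + \int[mu]_(x
  in D) k x)%E.
  rewrite -ge0_integralD//.
  - by apply: eq_integral => x _; rewrite /k addeC subeK.
  - by move=> x Dx; rewrite ltW ?k0.
have ffin : (\int[mu]_(x in D) (f x)%:E)%E \is a fin_num.
  by rewrite ge0_fin_numE// integral_ge0// => x Dx; rewrite lee_fin f0.
have kint : (\int[mu]_(x in D) k x = 0)%E.
  apply/eqP; rewrite eq_le integral_ge0 ?andbT => [|x Dx];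
    last by rewrite ltW ?k0.
  by move: gf; rewrite gE -[leRHS]adde0 leeD2lE.
have /(ae_eq_integral_abs mu mD mk) : (\int[mu]_(x in D) `|k x| = 0)%E.
  rewrite -kint; apply: eq_integral => x /set_mem Dx.
  by rewrite gee0_abs// ltW// k0.
apply: negligibleS => x Dx /= /(_ Dx) kx.
by have := k0 x Dx; rewrite kx ltxx.
Qed.

(** If [rho] is negative, [0 <= a u.+1 <= rho * a u] forces the whole sequence to vanish; otherwise
    the bounds multiply. *)
Lemma geometric_decay {R : realFieldType} (rho : R) (a : nat -> R) t :
  (forall u, 0 <= a u) -> (forall u, a u.+1 <= rho * a u) ->
    a t <= rho ^+ t * a 0.
Proof.
move=> a0 aS; have [rho0|rho0] := leP 0 rho.
  elim: t => [|t IHt]; first by rewrite expr0 mul1r.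
  by rewrite (le_trans (aS t))// exprS -mulrA ler_wpM2l.
have a_eq0 u : a u = 0.
  apply/eqP; rewrite eq_le a0 andbT -(nmulr_rge0 _ rho0).
  exact: le_trans (a0 u.+1) (aS u).
by rewrite !a_eq0 mulr0.
Qed.

(** * Geometric decay of the truncated error *)

Section ErrorDecay.
Context {R : realType} {l m n r s tau zeta : nat}.
Local Notation tubalR := (tubal R l).
Context {A : tubalR m r} {B : tubalR s n} {C : tubalR m n} {M :
  tubalR r r} {N : tubalR s s}
  {DS : probability (mtubal R l m tau) R} {DV : probability (mtubal R l n zeta) R}
  {Xstar : tubalR r s}
  {d : measure_display} {Omega : measurableType d} {P : probability Omega R}
  {X0 : {RV P >-> mtubal R l r s}}
  {S : nat -> {RV P >-> mtubal R l m tau}}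
  {V : nat -> {RV P >-> mtubal R l n zeta}}
  {X : nat -> Omega -> tubalR r s}.
Hypotheses (Mp : T_posdef M) (Np : T_posdef N)
  (AXB : A ** Xstar ** B = C)
  (DSE : forall t E, measurable E -> distribution P (S t) E = DS E)
  (DVE : forall t E, measurable E -> distribution P (V t) E = DV E)
  (indSV : mutually_independent P (source_sigma X0 S V))
  (X0E : forall w, X 0%N w = X0 w)
  (XS : forall t w, tcomplex (X t.+1 w) =
     idft (tesp_step A B C M N (S t w) (V t w) (dft (X t w)))).

Local Notation werr := (weighted_err M N Xstar).
Local Notation rho := (tesp_rho A B M N DS DV).
Local Notation F := (source_sigma X0 S V).

(** For the deterministic error [E] and weight 1, the one-step estimate bounds an expected squared
    norm by this quantity. *)
Lemma rho_tinner_ge0 (E : tubalR r s) : 0 <= rho * tinner E E.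
Proof.
have H a b : indep_past (P := P) (F := F) (past 0)
    (fun w => ent E a * ent E b * 1).
  apply: (indep_past_sub [::]) => //.
  exact: (indep_past_cst source_measurable indSV).
have := Ex_sketch_step (A := A) (B := B) Mp Np DSE DVE 0%N (fun=> E) (fun=> 1)
  (fun=> ler01) H.
rewrite mulr1 Ex_cst => le_rho. apply: (le_trans _ le_rho).
by apply: Rintegral_ge0 => w _; rewrite mulr1 tinner_ge0.
Qed.

Lemma rhoX_tinner_ge0 t (E : tubalR r s) : 0 <= rho ^+ t * tinner E E.
Proof.
have [rho0|rho0] := leP 0 rho; first by rewrite mulr_ge0 ?exprn_ge0 ?tinner_ge0.
have := rho_tinner_ge0 E; rewrite nmulr_rge0// => E0.
suff -> : tinner E E = 0 by rewrite mulr0.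
by apply/eqP; rewrite eq_le E0 tinner_ge0.
Qed.

Lemma werr_measurable a : measurable_fun setT
  (fun x : mtubal R l r s => ent (werr x) a).
Proof.
case: a => -[k i] j; rewrite /ent /=.
rewrite (_ : (fun _ => _) = fun x : mtubal R l r s =>
  (bcirc (tsqrt M) *m (bcirc (x : tubalR r s) - bcirc Xstar) *m bcirc (tsqrt N))
    (tagnat.Rank k i) (tagnat.Rank 0 j)).
  apply: mx_measurableM; last exact: mx_measurable_cst.
  apply: mx_measurableM; first exact: mx_measurable_cst.
  apply: mx_measurableD; [exact: bcirc_measurable|exact: mx_measurable_cst].
by apply/funext => x; rewrite bcirc_coord mxE !bcircM bcircB.
Qed.

Lemma sqerr_measurable : measurable_fun setT
  (fun x : mtubal R l r s => tinner (werr x) (werr x)).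
Proof.
rewrite (_ : (fun _ => _) = fun x : mtubal R l r s =>
  \sum_a (ent (werr x) a * ent (werr x) a)).
  by apply: measurable_sum => a; apply: measurable_funM; exact: werr_measurable.
by apply/funext => x; rewrite tinner_ent.
Qed.

Lemma ent_mul_le (E : tubalR r s) a b : `|ent E a * ent E b| <= tinner E E.
Proof.
have sq c : ent E c ^+ 2 <= tinner E E.
  rewrite tinner_ent (bigD1 c)//= -expr2 lerDl; apply: sumr_ge0 => e _.
  by rewrite -expr2 sqr_ge0.
have := sq a; have := sq b; rewrite ler_norml; move: (tinner E E) => u.
move: (ent E a) (ent E b) => x y hy hx.
have := sqr_ge0 (x + y); have := sqr_ge0 (x - y).
by move=> h1 h2; apply/andP; split; nra.
Qed.

Section Truncation.
Variables (D : set (mtubal R l r s)) (K : R).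
Hypotheses (mD : measurable D)
  (DK : forall x, D x -> tinner (werr x) (werr x) <= K).

Let iota w : R := \1_(X0 @^-1` D) w.

(** Truncation bounds the initial error only. Later errors are polynomials in it and in bounded
    projections, so they stay bounded on the same event. *)
Lemma err_indep t a b : indep_past (P := P) (F := F) (past t)
  (fun w => ent (werr (X t w)) a * ent (werr (X t w)) b * iota w).
Proof.
elim: t a b => [|t IHt] a b.
  pose phi (x : mtubal R l r s) : R := ent (werr x) a * ent (werr x) b * \1_D x.
  have bphi : bmeas phi.
    split.
      by apply: measurable_funM; [apply: measurable_funM; exact: werr_measurable|
        exact: measurable_indic].
    exists `|K| => x; rewrite /phi indicE;
      case: (boolP (x \in D)) => [/set_mem Dx|_] /=.
      rewrite mulr1 (le_trans (ent_mul_le _ _ _))// (le_trans (DK _ Dx))//.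
      exact: ler_norm.
    by rewrite mulr0 normr0.
  have zX := bmeas_in_RV (V := V) (S := S) None _ _ X0 phi erefl bphi.
  have := (indep_pastM source_measurable _ _ _ _
    (indep_past_cst source_measurable indSV 1) isT zX).1.
  rewrite [X in indep_past _ X](_ : _ = fun w =>
    ent (werr (X 0%N w)) a * ent (werr (X 0%N w)) b * iota w)//.
  by apply/funext => w; rewrite mul1r X0E.
have := sketch_step_indep (A := A) (B := B) Mp Np DSE DVE t (fun w =>
  werr (X t w)) iota IHt a b.
rewrite [X in indep_past _ X](_ : _ = fun w =>
  ent (werr (X t.+1 w)) a * ent (werr (X t.+1 w)) b * iota w)//.
by apply/funext => w; rewrite (tesp_step_err Mp Np AXB _ _ _ _ _ _ (XS t w)).
Qed.

Lemma Ex_err_decay t :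
  Ex P (fun w => tinner (werr (X t w)) (werr (X t w)) * iota w) <=
  rho ^+ t * Ex P (fun w => tinner (werr (X0 w)) (werr (X0 w)) * iota w).
Proof.
have iota0 w : 0 <= iota w by rewrite /iota indicE.
have := geometric_decay rho
  (fun u => Ex P (fun w => tinner (werr (X u w)) (werr (X u w)) * iota w)) t.
under [X in _ -> _ -> _ <= _ * X]eq_Ex do rewrite X0E.
apply=> u; first by apply: Rintegral_ge0 => w _; rewrite mulr_ge0 ?tinner_ge0.
have := Ex_sketch_step (A := A) (B := B) Mp Np DSE DVE u (fun w =>
  werr (X u w)) iota iota0 (err_indep u).
apply: le_trans; rewrite le_eqVlt; apply/orP; left; apply/eqP; apply: eq_Ex => w.
by rewrite (tesp_step_err Mp Np AXB _ _ _ _ _ _ (XS u w)).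
Qed.

End Truncation.

End ErrorDecay.

Lemma EFin_Ex_setI {R : realType} {d} {T : measurableType d} (P : probability T R)
    (D : set T) (f : T -> R) : bmeas (fun w => f w * \1_D w) ->
  (\int[P]_(w in D) (f w)%:E)%E = (Ex P (fun w => f w * \1_D w))%:E.
Proof.
move=> bf; rewrite integral_mkcond /Ex /Rintegral fineK; last first.
  by apply: integrable_fin_num => //; exact: bmeas_integrable.
apply: eq_integral => w _; rewrite patchE indicE.
by case: ifPn => wD; rewrite ?mulr1 ?mulr0.
Qed.

Theorem theorem7 (R : realType) (l m n r s tau zeta : nat)
    (A : tubal R l m r) (B : tubal R l s n) (C : tubal R l m n)
    (M : tubal R l r r) (N : tubal R l s s)
    (DS : probability (mtubal R l m tau) R)
    (DV : probability (mtubal R l n zeta) R)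
    (Xstar : tubal R l r s)
    (d : measure_display) (Omega : measurableType d) (P : probability Omega R)
    (X0 : {RV P >-> mtubal R l r s})
    (S : nat -> {RV P >-> mtubal R l m tau})
    (V : nat -> {RV P >-> mtubal R l n zeta})
    (X : nat -> Omega -> tubal R l r s) :
  T_posdef M -> T_posdef N ->
  herm_posdef (Emx DS (fun S0 => bdiag (dft (Zproj A M S0)))) ->
  herm_posdef (Emx DV (fun V0 => bdiag (dft (Wproj B N V0)))) ->
  A ** Xstar ** B = C ->
  (forall t E, measurable E -> distribution P (S t) E = DS E) ->
  (forall t E, measurable E -> distribution P (V t) E = DV E) ->
  mutually_independent P (source_sigma X0 S V) ->
  (forall w, X 0%N w = X0 w) ->
  (forall t w, tcomplex (X t.+1 w) =
     idft (tesp_step A B C M N (S t w) (V t w) (dft (X t w)))) ->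
  forall t : nat, (1 <= t)%N ->
  forall Y : Omega -> \bar R,
    cond_expectation P (g_sigma_algebra_preimage X0)
      (fun w => (sqnormF M N (tsub (X t w) Xstar))%:E) Y ->
    {ae P, forall w,
      (Y w <= (tesp_rho A B M N DS DV ^+ t *
               sqnormF M N (tsub (X0 w) Xstar))%:E)%E}.
Proof.
move=> Mp Np _ _ AXB DSE DVE ind X0E XS t _ Y [mY intY].
pose err x := tinner (weighted_err M N Xstar x) (weighted_err M N Xstar x).
have errE x : sqnormF M N (tsub x Xstar) = err x.
  by rewrite sqnormFE//; exact: T_posdef_psd.
pose h (x : mtubal R l r s) := tesp_rho A B M N DS DV ^+ t * err x.
have mh : measurable_fun setT h.
  by apply: measurable_funM => //; exact: sqerr_measurable.
have h0 x : 0 <= h x by exact: (rhoX_tinner_ge0 Mp Np DSE DVE ind).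
(* The event where the bound fails. It lies in the sigma-algebra of [X0], so it is the preimage of a
   set [D'] of initial values. *)
pose D := [set w | ((h (X0 w))%:E < Y w)%E].
have [D' mD' D'E] : g_sigma_algebra_preimage X0 D.
  have mYX : measurable_fun setT (Y : g_sigma_algebra_preimageType X0 -> \bar R).
    by move=> _ E mE; rewrite setTI; exact: mY.
  have mX0 : measurable_fun setT (X0 : g_sigma_algebra_preimageType X0 ->
    mtubal R l r s).
    by move=> _ E mE; exists E.
  have mhX : measurable_fun setT
      ((fun w => (h (X0 w))%:E) : g_sigma_algebra_preimageType X0 -> \bar R).
    by apply/measurable_EFinP; exact: (measurableT_comp mh mX0).
  by have := measurable_lte measurableT mhX mYX; rewrite setTI.
have D'D w : D' (X0 w) = D w by rewrite -D'E setTI.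
(* The levels of the initial error exhaust [D'] by countably many sets on which all integrals
   involved are finite. *)
pose Dn (k : nat) := D' `&` [set x : mtubal R l r s | err x <= k%:R].
have mDn k : measurable (Dn k).
  apply: measurableI => //.
  rewrite -[X in measurable X]setTI (_ :
    [set x | _] = err @^-1` `]-oo, k%:R]%classic).
    exact: sqerr_measurable.
  by apply/seteqP; split => x /=; rewrite in_itv.
have nDn k : P.-negligible (X0 @^-1` (Dn k)).
  have DK x : Dn k x -> err x <= k%:R by case.
  have mB : measurable (X0 @^-1` (Dn k)) by exact: measurable_funPTI.
  have bU u : bmeas (fun w => err (X u w) * \1_(X0 @^-1` (Dn k)) w).
    rewrite (_ : (fun _ => _) = fun w => \sum_a
      ent (weighted_err M N Xstar (X u w)) a * ent (weighted_err M N Xstar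
        (X u w)) a *
        \1_(X0 @^-1` (Dn k)) w).
      apply: bmeas_sum => a.
      exact: (err_indep Mp Np AXB DSE DVE ind X0E XS _ _ (mDn k) DK u a a).1.
    by apply/funext => w; rewrite /err tinner_ent mulr_suml.
  have bU0 : bmeas (fun w => err (X0 w) * \1_(X0 @^-1` (Dn k)) w).
    rewrite (_ : (fun _ => _) = fun w => err (X 0%N w) * \1_(X0 @^-1` (Dn k)) w).
      exact: bU.
    by apply/funext => w; rewrite X0E.
  have bh : bmeas (fun w => h (X0 w) * \1_(X0 @^-1` (Dn k)) w).
    rewrite (_ : (fun _ => _) = fun w => tesp_rho A B M N DS DV ^+ t *
      (err (X0 w) * \1_(X0 @^-1` (Dn k)) w)); first exact: bmeasZ.
    by apply/funext => w; rewrite /h mulrA.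
  (* On this event [Y] exceeds the bound everywhere, yet by the decay estimate its integral does not
     exceed that of the bound. *)
  apply: (integral_lt_negligible P _ (fun w => h (X0 w)) Y) => //.
  - apply: measurable_funTS; exact: measurableT_comp.
  - move=> mB' E mE; apply: measurableI => //.
    by have [E' mE' <-] := mY E mE; rewrite setTI; exact: measurable_funPTI.
  - by move=> w [+ _]; rewrite D'D.
  - by rewrite EFin_Ex_setI// ltry.
  rewrite intY; last by exists (Dn k) => //; rewrite setTI.
  have -> : (fun w => (sqnormF M N (tsub (X t w) Xstar))%:E) =
      (fun w => (err (X t w))%:E) by apply/funext => w; rewrite errE.
  rewrite (EFin_Ex_setI P _ (fun w => err (X t w)))// EFin_Ex_setI// lee_fin.
  apply: (le_trans (Ex_err_decay Mp Np AXB DSE DVE ind X0E XS _ _ (mDn k) DK t)).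
  rewrite -ExZ//; apply: le_Ex => //; first exact: bmeasZ.
  by move=> w; rewrite /h mulrA.
apply: negligibleS (negligible_bigcup nDn) => w /= /negP.
rewrite -ltNge errE => Dw.
have D'w : D' (X0 w) by rewrite D'D.
exists (Num.bound (err (X0 w))) => //; split=> //=.
by rewrite ltW// archi_boundP// tinner_ge0.
Qed.
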